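(* Let $f\colon\mathbb{R}\to\mathbb{R}$ be locally Lipschitz continuous and $u_0\in C^1_{\mathrm{ub}}(\mathbb{R})$. Suppose $u_0(x)\to\phi_\pm$ as $x\to\pm\infty$, where $\phi_+$ and $\phi_-$ are nonzero and have the same sign. Let $u\in C([0,\infty),C_{\mathrm{ub}}(\mathbb{R}))$ be the unique global mild solution of $u_t=u_{xx}+f(u)_x$ with $u(0,\cdot)=u_0$. Then there exists a time $T>0$ such that for all $t>T$ the function $u(t,\cdot)$ has no zeros.
   Context: $C_{\mathrm{ub}}(\mathbb{R})$ denotes the space of bounded, uniformly continuous functions $\mathbb{R}\to\mathbb{R}$ with the sup-norm, and $C^1_{\mathrm{ub}}(\mathbb{R})$ the space of $C^1$ functions $g$ with $g,g'\in C_{\mathrm{ub}}(\mathbb{R})$. A mild solution of $u_t=u_{xx}+f(u)_x$ with initial condition $u_0$ is a continuous curve $u\in C([0,\infty),C_{\mathrm{ub}}(\mathbb{R}))$ satisfying $$u(t,\cdot)=e^{\partial_x^2 t}u_0+\int_0^t\partial_x e^{\partial_x^2(t-s)}f(u(s,\cdot))\,ds,$$ where $(e^{\partial_x^2 t}g)(x)=\int_{\mathbb{R}}(4\pi t)^{-1/2}e^{-(x-y)^2/(4t)}g(y)\,dy$. Such a global mild solution exists and is unique for locally Lipschitz $f$ and $u_0\in C^1_{\mathrm{ub}}(\mathbb{R})$. *)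

(* Defs.v *)
From HB Require Import structures.
From mathcomp Require Import all_boot all_order all_algebra.
From mathcomp Require Import all_classical all_reals all_analysis.
Set Implicit Arguments. Unset Strict Implicit. Unset Printing Implicit Defensive.
Import Order.TTheory GRing.Theory Num.Theory.
Import numFieldNormedType.Exports.
Local Open Scope classical_set_scope.
Local Open Scope ring_scope.

Section Defs.
Variable R : realType.

Definition heat_kernel (t z : R) : R :=
  (Num.sqrt (4 * pi * t))^-1 * expR (- (z ^+ 2) / (4 * t)).

Definition heat_kernel_dx (t z : R) : R := - (z / (2 * t)) * heat_kernel t z.

Definition heat_sg (t : R) (g : R -> R) (x : R) : R :=
  Rintegral lebesgue_measure setT (fun y => heat_kernel t (x - y) * g y).

Definition dx_heat_sg (t : R) (g : R -> R) (x : R) : R :=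
  Rintegral lebesgue_measure setT (fun y => heat_kernel_dx t (x - y) * g y).

Definition bounded_fun (g : R -> R) : Prop := exists M : R, forall x, `|g x| <= M.

Definition unif_cont (g : R -> R) : Prop :=
  forall eps : R, 0 < eps -> exists delta : R, 0 < delta /\
    forall x y : R, `|x - y| < delta -> `|g x - g y| < eps.

Definition C_ub (g : R -> R) : Prop := bounded_fun g /\ unif_cont g.

Definition C1_ub (g : R -> R) : Prop :=
  exists g' : R -> R, (forall x, is_derive x (1:R) g (g' x)) /\ C_ub g /\ C_ub g'.

Definition locally_lipschitz (f : R -> R) : Prop :=
  forall M : R, 0 < M -> exists L : R, forall x y : R,
    `|x| <= M -> `|y| <= M -> `|f x - f y| <= L * `|x - y|.

Definition curve_C_ub (u : R -> R -> R) : Prop :=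
  (forall t, 0 <= t -> C_ub (u t)) /\
  (forall t0, 0 <= t0 -> forall eps : R, 0 < eps -> exists delta : R, 0 < delta /\
     forall t, 0 <= t -> `|t - t0| < delta -> forall x, `|u t x - u t0 x| <= eps).

(* mild solution of u_t = u_xx + f(u)_x with u(0) = u0; the Duhamel (Bochner)
   integral is evaluated pointwise in x *)
Definition mild_solution (f : R -> R) (u0 : R -> R) (u : R -> R -> R) : Prop :=
  curve_C_ub u /\
  forall t, 0 <= t -> forall x,
    u t x = (if t == 0 then u0 x else heat_sg t u0 x) +
      Rintegral lebesgue_measure `[0, t]
        (fun s => dx_heat_sg (t - s) (fun y => f (u s y)) x).

End Defs.

(* Main.v *)
(** A primitive [Phi] in space of the solution [u] satisfies
    [Phi_t = Phi_xx + f(Phi_x)].  Doubling the space variable, at a first point where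
    [Phi(t,x) - Phi(t,y) - omega(t,x-y)] vanishes the first-order conditions give
    [Phi_x(t,x) = Phi_x(t,y)], so the two nonlinear terms cancel exactly, whatever [f]
    is, and the second-order condition along [(1,-1)] leaves [omega_t <= 4 omega_zz] as
    the only requirement on [omega].  The choice
    [omega(t,z) = b z - A z / (1+t) exp(- z^2 / (16 (1+t)))] lies below the initial
    increments of [Phi] when [u0] stays above a positive constant near both infinities,
    and letting [y] tend to [x] yields [u(t,.) >= b - A / (1+t)], which is positive for
    large [t].  To work with classical derivatives, all kernels in the Duhamel formula
    are shifted by a time [d > 0], which changes [u] by [O(sqrt d)] only. *)

Require Import Defs.
From HB Require Import structures.
From mathcomp Require Import all_boot all_order all_algebra.
From mathcomp Require Import all_classical all_reals all_analysis.
From mathcomp Require Import measurable_realfun ring lra.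
Import Order.TTheory GRing.Theory Num.Theory.
Import numFieldNormedType.Exports.
Local Open Scope classical_set_scope.
Local Open Scope ring_scope.
Set Implicit Arguments.
Unset Strict Implicit.
Unset Printing Implicit Defensive.

(** * Elementary calculus of real derivatives *)

Section RealCalculus.
Variable R : realType.
Implicit Types (x y z h l m : R) (F G : R -> R).

(** The second space derivative of the heat kernel has L1 norm of order [1 / (t - s)], which is not
    integrable at [s = t]; this is the reason for the shift by [d]. After it the forcing in the
    equation for [Phi] is the heat semigroup at age [d] applied to [f(u)], not [f(Phi_x)]. If [r]
    bounds the distance between the two, the cancellation leaves an error [2 r], hence a loss
    [2 r t] in the comparison, harmless because [t] is fixed before [r] is made small. The plane
    being unbounded, a penalty [eps exp(c t) (1 + x^2 + y^2)] is added. It perturbs the first-order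
    conditions, so a Lipschitz constant of [f] enters, but only through [c], and it disappears as
    [eps] tends to 0. The barrier comes from the dipole solution
    [z (1+t)^(-3/2) exp(- z^2 / (16 (1+t)))] of [w_t = 4 w_zz]. With the power -1 in place of -3/2
    it decays more slowly, which gives [omega_t <= 4 omega_zz] with room, while its slope at [z = 0]
    still tends to 0. Negative limits reduce to positive ones through [v = - u], which solves the
    equation with flux [- f(- v)]. *)

Lemma is_derive_add F G x l m : is_derive x (1:R) F l -> is_derive x (1:R) G m ->
  is_derive x (1:R) (fun z => F z + G z) (l + m).
Proof. by move=> ? ?; apply: is_derive_eq. Qed.

Lemma is_derive_opp F x l : is_derive x (1:R) F l ->
  is_derive x (1:R) (fun z => - F z) (- l).
Proof. by move=> ?; apply: is_derive_eq. Qed.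

Lemma is_derive_mul F G x l m : is_derive x (1:R) F l -> is_derive x (1:R) G m ->
  is_derive x (1:R) (fun z => F z * G z) (l * G x + F x * m).
Proof. by move=> ? ?; apply: is_derive_eq; rewrite /GRing.scale/=; ring. Qed.

Lemma is_derive_exprn F n x l : is_derive x (1:R) F l ->
  is_derive x (1:R) (fun z => F z ^+ n.+1) (n.+1%:R * F x ^+ n * l).
Proof.
move=> Fl; elim: n => [|n IHn].
  by rewrite (_ : (fun z => _) = F)// expr0 !mul1r.
rewrite (_ : (fun z => _) = (fun z => F z * F z ^+ n.+1)); last first.
  by apply/funext => z; rewrite exprS.
have /is_derive_eq := is_derive_mul Fl IHn; apply.
by rewrite exprS (natrD _ 1 n.+1); ring.
Qed.

Lemma is_derive_inv F x l : F x != 0 -> is_derive x (1:R) F l ->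
  is_derive x (1:R) (fun z => (F z)^-1) (- l / F x ^+ 2).
Proof.
move=> Fx0 Fl; have /is_derive_eq := @is_deriveV R F x l 1 Fx0 Fl; apply.
by rewrite /GRing.scale/=; field.
Qed.

Lemma is_derive_exp F x l : is_derive x (1:R) F l ->
  is_derive x (1:R) (fun z => expR (F z)) (expR (F x) * l).
Proof. by move=> ?; apply: (@is_derive1_comp R expR F). Qed.

Lemma is_derive_cont F x l : is_derive x (1:R) F l -> {for x, continuous F}.
Proof.
by move=> [Fx _]; apply: differentiable_continuous; apply/derivable1_diffP.
Qed.

Lemma MVT_between F (dF : R -> R) x y :
  (forall z, Num.min x y <= z <= Num.max x y -> is_derive z (1:R) F (dF z)) ->
  exists2 z, Num.min x y <= z <= Num.max x y & F y - F x = dF z * (y - x).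
Proof.
wlog xy : x y / x <= y.
  move=> H; have [xy|] := boolP (x <= y); first exact: H.
  rewrite -ltNge => /ltW yx.
  rewrite minC maxC => /(H _ _ yx)[z zyx E]; exists z => //.
  by rewrite -[LHS]opprB E; ring.
rewrite (min_idPl xy) (max_idPr xy) => dFE.
have dFE' z : z \in `]x, y[ -> is_derive z (1:R) F (dF z).
  by rewrite in_itv/= => /andP[/ltW xz /ltW zy]; apply: dFE; rewrite xz.
have cF : {within `[x, y], continuous F}.
  apply: continuous_in_subspaceT => /= z.
  by rewrite inE/= in_itv/= => /dFE /is_derive_cont.
have [z] := MVT_segment xy dFE' cF.
by rewrite in_itv/= => zxy E; exists z.
Qed.

Lemma lipschitz_of_derive F (dF : R -> R) C x y :
  (forall z, Num.min x y <= z <= Num.max x y -> is_derive z (1:R) F (dF z)) ->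
  (forall z, Num.min x y <= z <= Num.max x y -> `|dF z| <= C) ->
  `|F y - F x| <= C * `|y - x|.
Proof.
move=> /MVT_between[z zxy ->] dFC.
by rewrite normrM ler_wpM2r// dFC.
Qed.

(** The mean value theorem is applied to [F] and then to [dF]; losing the factor 1/2 of Taylor's
    formula is harmless. *)
Lemma taylor1_of_derive F (dF ddF : R -> R) C x y :
  (forall z, Num.min x y <= z <= Num.max x y -> is_derive z (1:R) F (dF z)) ->
  (forall z, Num.min x y <= z <= Num.max x y -> is_derive z (1:R) dF (ddF z)) ->
  (forall z, Num.min x y <= z <= Num.max x y -> `|ddF z| <= C) ->
  `|F y - F x - (y - x) * dF x| <= C * (y - x) ^+ 2.
Proof.
move=> FE dFE ddFC; have [z zxy ->] := MVT_between FE.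
have zsub w : Num.min x z <= w <= Num.max x z -> Num.min x y <= w <= Num.max x y.
  move=> /andP[w1 w2]; move: zxy => /andP[z1 z2].
  by rewrite (le_trans _ w1) ?(le_trans w2)// ?le_min ?ge_max ?z1 ?z2 ?ge_min ?le_max lexx.
have dF_lip : `|dF z - dF x| <= C * `|z - x|.
  by apply: lipschitz_of_derive => w /zsub; [exact: dFE|exact: ddFC].
rewrite (_ : _ - _ = (y - x) * (dF z - dF x)); last by ring.
rewrite normrM -real_normK ?num_real// expr2 mulrCA ler_wpM2l//.
apply: (le_trans dF_lip); rewrite ler_wpM2l//.
  have := ddFC x; rewrite ge_min lexx/= le_max lexx/= => /(_ isT).
  exact: le_trans.
move: zxy; have [xy|/ltW yx] := leP x y; move=> /andP[z1 z2].
  by rewrite !ger0_norm ?subr_ge0// lerD2r.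
by rewrite !ler0_norm ?subr_le0// lerN2 lerD2r.
Qed.

(** Replaces differentiation under the integral sign: a quadratic remainder bound, uniform in the
    integration variable, survives integration, and this criterion then recovers the derivative. *)
Lemma is_derive_of_remainder F x l C :
  (forall h, `|h| <= 1 -> `|F (x + h) - F x - h * l| <= C * h ^+ 2) ->
  is_derive x (1:R) F l.
Proof.
move=> Frem.
have C0 : 0 <= C by have := Frem 1; rewrite normr1 expr1n mulr1 => /(_ (lexx _)); exact: le_trans.
have cvgF : h^-1 *: (F (h *: (1:R) + x) - F x) @[h --> 0^'] --> l.
  apply/cvgrPdist_le => e e0.
  near=> h.
  have h0 : h != 0 by near: h; exact: nbhs_dnbhs_neq.
  have h1 : `|h| <= 1.
    by near: h; apply: dnbhs0_le.
  have hC : `|h| <= e / (C + 1).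
    by near: h; apply: dnbhs0_le; rewrite divr_gt0// ltr_wpDl.
  rewrite /GRing.scale/= mulr1 (addrC h).
  rewrite (_ : l - _ = - (h^-1 * (F (x + h) - F x - h * l))); last by field.
  rewrite normrN normrM normfV ler_pdivrMl ?normr_gt0//.
  apply: (le_trans (Frem _ h1)).
  rewrite -real_normK ?num_real// expr2 mulrCA ler_wpM2l//.
  apply: (le_trans (ler_wpM2l C0 hC)).
  rewrite mulrCA; apply: ler_piMr; first exact: ltW.
  by rewrite ler_pdivrMr ?mul1r ?lerDl// ltr_wpDl.
split; first by apply/cvg_ex; exists l.
exact: cvg_lim cvgF.
Unshelve. all: by end_near. Qed.

Lemma is_derive_affine (a x : R) : is_derive x (1:R) (fun z => a * z) a.
Proof.
have /is_derive_eq := is_derive_mul (is_derive_cst a x 1) (is_derive_id x (1:R)).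
by apply; rewrite mul0r mulr1 add0r.
Qed.

End RealCalculus.
Arguments lipschitz_of_derive {R} F dF C x y.
Arguments taylor1_of_derive {R} F dF ddF C x y.

Lemma is_derive_congr (R : realType) (F : R -> R) (x l m : R) :
  l = m -> is_derive x (1:R) F l -> is_derive x (1:R) F m.
Proof. by move=> ->. Qed.

(** The derivative is an existential variable filled in by the differentiation rules, with
    hypotheses of the context as leaves; the first goal left is its equality with the announced
    derivative. *)
Ltac is_deriv :=
  eapply is_derive_congr;
  [|repeat first [ eassumption | apply is_derive_exprn | apply is_derive_id | apply is_derive_cst
   | apply is_derive_add | apply is_derive_opp | apply is_derive_mul
   | apply is_derive_exp | apply is_derive_inv]]; cbn beta.

(** * Explicit derivatives of the heat kernel *)

Section Kernel.
Variable R : realType.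
Implicit Types (t z : R).

(** Space derivatives go up to order four because, by the heat equation, each time derivative equals
    two space derivatives, and a first-order expansion in time has a second time derivative in its
    remainder. *)
Definition heat_kernel_dxx t z : R :=
  ((z / (2 * t)) ^+ 2 - (2 * t)^-1) * heat_kernel t z.
Definition heat_kernel_dxxx t z : R :=
  (- (z / (2 * t)) ^+ 3 + 3 * z * (2 * t)^-1 ^+ 2) * heat_kernel t z.
Definition heat_kernel_dxxxx t z : R :=
  ((z / (2 * t)) ^+ 4 - 6 * z ^+ 2 * (2 * t)^-1 ^+ 3 + 3 * (2 * t)^-1 ^+ 2) *
  heat_kernel t z.

Lemma is_derive_heat_kernel t z : t != 0 ->
  is_derive z (1:R) (heat_kernel t) (heat_kernel_dx t z).
Proof.
move=> t0; rewrite /heat_kernel; is_deriv.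
by rewrite /heat_kernel_dx /heat_kernel; set s := (Num.sqrt _)^-1; field.
Qed.

Lemma is_derive_heat_kernel_dx t z : t != 0 ->
  is_derive z (1:R) (heat_kernel_dx t) (heat_kernel_dxx t z).
Proof.
move=> t0; have dhk := is_derive_heat_kernel z t0.
rewrite /heat_kernel_dx; is_deriv.
by rewrite /heat_kernel_dxx /heat_kernel_dx; field.
Qed.
Lemma is_derive_heat_kernel_dxx t z : t != 0 ->
  is_derive z (1:R) (heat_kernel_dxx t) (heat_kernel_dxxx t z).
Proof.
move=> t0; have dhk := is_derive_heat_kernel z t0.
rewrite /heat_kernel_dxx; is_deriv.
by rewrite /heat_kernel_dxxx /heat_kernel_dx; field.
Qed.

Lemma is_derive_time_heat_kernel t z : 0 < t ->
  is_derive t (1:R) (fun s => heat_kernel s z) (heat_kernel_dxx t z).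
Proof.
rewrite /heat_kernel => t0; have t0' := lt0r_neq0 t0.
have pi0 := pi_gt0 R.
have s0 : 0 < Num.sqrt (4 * pi * t) by rewrite sqrtr_gt0 !mulr_gt0.
have dsqrt : is_derive t (1:R) (fun t => Num.sqrt (4 * pi * t))
    ((2 * Num.sqrt (4 * pi * t))^-1 * (4 * pi)).
  apply: (@is_derive1_comp R Num.sqrt (fun t => 4 * pi * t)).
    by apply: is_derive1_sqrt; rewrite !mulr_gt0.
  exact: is_derive_affine.
is_deriv; [|exact: lt0r_neq0|by rewrite mulf_neq0].
have s2 : Num.sqrt (4 * pi * t) ^+ 2 = 4 * pi * t.
  by rewrite sqr_sqrtr// !mulr_ge0// ltW.
rewrite /heat_kernel_dxx /heat_kernel s2.
move: (pi : R) pi0 s0 {dsqrt s2} => p p0 s0.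
by field; rewrite t0' !lt0r_neq0.
Qed.

Lemma is_derive_time_heat_kernel_dx t z : 0 < t ->
  is_derive t (1:R) (fun s => heat_kernel_dx s z) (heat_kernel_dxxx t z).
Proof.
rewrite /heat_kernel_dx => t0; have t0' := lt0r_neq0 t0.
have dhk := is_derive_time_heat_kernel z t0.
is_deriv; last by rewrite mulf_neq0.
by rewrite /heat_kernel_dxxx /heat_kernel_dxx; field.
Qed.

Lemma is_derive_time_heat_kernel_dxx t z : 0 < t ->
  is_derive t (1:R) (fun s => heat_kernel_dxx s z) (heat_kernel_dxxxx t z).
Proof.
rewrite /heat_kernel_dxx => t0; have t0' := lt0r_neq0 t0.
have dhk := is_derive_time_heat_kernel z t0.
is_deriv; [|by rewrite mulf_neq0..].
by rewrite /heat_kernel_dxxxx /heat_kernel_dxx; field.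
Qed.

End Kernel.

(** * Gaussian bounds on the kernel and its derivatives *)

Section KernelBounds.
Variable R : realType.
Implicit Types (d t z h p T : R).

Lemma heat_kernel_gt0 t z : 0 < t -> 0 < heat_kernel t z.
Proof.
by move=> t0; rewrite mulr_gt0 ?expR_gt0// invr_gt0 sqrtr_gt0 !mulr_gt0// pi_gt0.
Qed.

Lemma expr_le_sqr z i : (i <= 4)%N -> `|z| ^+ i <= (1 + z ^+ 2) ^+ 2.
Proof.
have z1 : `|z| <= 1 + z ^+ 2.
  by have := real_normK (num_real z); have := normr_ge0 z; nra.
have z2 : `|z| ^+ 2 = z ^+ 2 by rewrite real_normK// num_real.
case: i => [|[|[|[|[|//]]]]] _; have := normr_ge0 z; have := sqr_ge0 z.
- by rewrite expr0; nra.
- by rewrite expr1; nra.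
- by rewrite -[`|z| ^+ _]/(`|z| ^+ 2) z2; nra.
- by rewrite (exprD _ 1 2) z2; nra.
- by rewrite (exprM _ 2 2) z2; nra.
Qed.

Lemma sqr_le_expR T z : 0 < T ->
  (1 + z ^+ 2) ^+ 2 <= (1 + 16 * T) ^+ 2 * expR (z ^+ 2 / (8 * T)).
Proof.
move=> T0.
rewrite (_ : z ^+ 2 / (8 * T) = z ^+ 2 / (16 * T) + z ^+ 2 / (16 * T)); last first.
  by field; rewrite lt0r_neq0.
rewrite expRD -expr2 -exprMn ler_sqr ?nnegrE; last 2 first.
- by rewrite addr_ge0// sqr_ge0.
- by rewrite mulr_ge0 ?expR_ge0// addr_ge0// mulr_ge0// ltW.
have e1 := expR_ge1Dx (z ^+ 2 / (16 * T)).
apply: (@le_trans _ _ ((1 + 16 * T) * (1 + z ^+ 2 / (16 * T)))); last first.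
  by rewrite ler_pM2l// addr_gt0// mulr_gt0.
have -> : (1 + 16 * T) * (1 + z ^+ 2 / (16 * T)) =
    1 + z ^+ 2 + (16 * T + z ^+ 2 / (16 * T)) by field; rewrite lt0r_neq0.
have T16 : 0 <= 16 * T by rewrite mulr_ge0// ltW.
by rewrite lerDl; apply: addr_ge0 => //; apply: divr_ge0 => //; exact: sqr_ge0.
Qed.

(** The prefactor is largest at [d] and the Gaussian at [T]. Half of the exponent, [z^2 / (8 T)],
    absorbs the polynomial, and the other half is the kernel at time [2 T] up to normalization. The
    10 is the sum 1 + 6 + 3 of the coefficients in the fourth derivative, the worst case. *)
Lemma heat_kernel_poly_bound d T : 0 < d -> exists2 C, 0 <= C &
  forall t z (p : R), d <= t <= T ->
    `|p| <= 10 * ((1 + (2 * d)^-1) ^+ 4 * (1 + z ^+ 2) ^+ 2) ->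
    `|p * heat_kernel t z| <= C * heat_kernel (2 * T) z.
Proof.
move=> d0; have [dT|Td] := leP d T; last first.
  by exists 0 => // t z p /andP[dt /(le_trans dt)]; rewrite leNgt Td.
have T0 := lt_le_trans d0 dT.
have s0 (a : R) : 0 < a -> 0 < Num.sqrt (4 * pi * a).
  by move=> a0; rewrite sqrtr_gt0 !mulr_gt0// pi_gt0.
exists (10 * (1 + (2 * d)^-1) ^+ 4 * (1 + 16 * T) ^+ 2 * (Num.sqrt (4 * pi * d))^-1 *
    Num.sqrt (4 * pi * (2 * T))).
  apply: mulr_ge0; last exact: sqrtr_ge0.
  apply: mulr_ge0; last by rewrite invr_ge0 sqrtr_ge0.
  apply: mulr_ge0; last exact: exprn_even_ge0.
  by apply: mulr_ge0 => //; exact: exprn_even_ge0.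
move=> t z p /andP[dt tT] pb; have t0 := lt_le_trans d0 dt.
rewrite normrM (gtr0_norm (heat_kernel_gt0 z t0)).
have hk_le : heat_kernel t z <= (Num.sqrt (4 * pi * d))^-1 * expR (- z ^+ 2 / (4 * T)).
  apply: ler_pM; [by rewrite invr_ge0 sqrtr_ge0|exact: expR_ge0| |].
    have p4 : 0 < 4 * pi :> R by rewrite mulr_gt0// pi_gt0.
    rewrite lef_pV2 ?posrE ?s0//; apply: ler_wsqrtr.
    by rewrite ler_pM2l.
  rewrite ler_expR !mulNr lerN2 ler_wpM2l ?sqr_ge0// lef_pV2 ?posrE ?mulr_gt0//.
  by rewrite ler_pM2l.
apply: (le_trans (ler_pM (normr_ge0 _) (ltW (heat_kernel_gt0 z t0)) pb hk_le)).
have := sqr_le_expR z T0.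
set A := (1 + (2 * d)^-1) ^+ 4; set B := (1 + 16 * T) ^+ 2.
set D := (Num.sqrt (4 * pi * d))^-1 => zle.
rewrite /heat_kernel (_ : - z ^+ 2 / (4 * T) =
    - (z ^+ 2 / (8 * T)) + - z ^+ 2 / (4 * (2 * T))); last first.
  by field; rewrite lt0r_neq0.
rewrite expRD.
set e1 := expR (- (z ^+ 2 / (8 * T))); set e2 := expR (- z ^+ 2 / (4 * (2 * T))).
have sT := lt0r_neq0 (s0 (2 * T) (mulr_gt0 (ltr0Sn _ 1) T0)).
have -> : 10 * A * B * D * Num.sqrt (4 * pi * (2 * T)) *
    ((Num.sqrt (4 * pi * (2 * T)))^-1 * e2) = 10 * A * D * e2 * B.
  by move: (Num.sqrt (4 * pi * (2 * T))) sT => s sT; field.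
have -> : 10 * (A * (1 + z ^+ 2) ^+ 2) * (D * (e1 * e2)) =
    10 * A * D * e2 * ((1 + z ^+ 2) ^+ 2 * e1) by ring.
apply: ler_wpM2l.
  apply: mulr_ge0; last exact: expR_ge0.
  apply: mulr_ge0; last by rewrite invr_ge0 sqrtr_ge0.
  by apply: mulr_ge0 => //; exact: exprn_even_ge0.
by rewrite -ler_pdivlMr ?expR_gt0// /e1 expRN invrK.
Qed.

(** Comes from [(z + h)^2 >= z^2 / 2 - h^2], that is, [(z + 2 h)^2 >= 0]. One kernel thus dominates
    all translates by at most 1. *)
Lemma heat_kernel_shift T z h : 0 < T -> `|h| <= 1 ->
  heat_kernel T (z + h) <=
    Num.sqrt 2 * expR (4 * T)^-1 * heat_kernel (2 * T) z.
Proof.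
move=> T0 h1.
have -> : Num.sqrt 2 * expR (4 * T)^-1 * heat_kernel (2 * T) z =
    (Num.sqrt (4 * pi * T))^-1 * expR ((4 * T)^-1 - z ^+ 2 / (4 * (2 * T))).
  rewrite /heat_kernel (_ : 4 * pi * (2 * T) = 2 * (4 * pi * T)); last by ring.
  rewrite sqrtrM// invfM expRD mulNr.
  by field; rewrite !lt0r_neq0// sqrtr_gt0 !mulr_gt0// pi_gt0.
rewrite ler_pM2l; last by rewrite invr_gt0 sqrtr_gt0 !mulr_gt0// pi_gt0.
rewrite ler_expR.
have -> : (4 * T)^-1 - z ^+ 2 / (4 * (2 * T)) = (1 - z ^+ 2 / 2) / (4 * T).
  by field; rewrite lt0r_neq0.
rewrite ler_pM2r ?invr_gt0 ?mulr_gt0//.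
have h2 : h ^+ 2 <= 1 by rewrite -real_normK ?num_real// exprn_ile1.
by have := sqr_ge0 (z + 2 * h); nra.
Qed.

(** The time [4 T] results from two doublings, one to absorb the polynomial and one to absorb the
    translation. *)
Lemma heat_kernel_derivs_bound d T : 0 < d -> exists2 C, 0 <= C &
  forall t z h, d <= t <= T -> `|h| <= 1 ->
  [/\ `|heat_kernel t (z + h)| <= C * heat_kernel (4 * T) z,
      `|heat_kernel_dx t (z + h)| <= C * heat_kernel (4 * T) z,
      `|heat_kernel_dxx t (z + h)| <= C * heat_kernel (4 * T) z,
      `|heat_kernel_dxxx t (z + h)| <= C * heat_kernel (4 * T) z &
      `|heat_kernel_dxxxx t (z + h)| <= C * heat_kernel (4 * T) z].
Proof.
move=> d0; have [C C0 HC] := heat_kernel_poly_bound T d0.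
exists (C * (Num.sqrt 2 * expR (4 * (2 * T))^-1)).
  by rewrite !mulr_ge0 ?sqrtr_ge0 ?expR_ge0.
move=> t z h /andP[dt tT] h1.
have t0 := lt_le_trans d0 dt; have T0 := lt_le_trans t0 tT.
have shift p : `|p| <= 10 * ((1 + (2 * d)^-1) ^+ 4 * (1 + (z + h) ^+ 2) ^+ 2) ->
    `|p * heat_kernel t (z + h)| <= C * (Num.sqrt 2 * expR (4 * (2 * T))^-1) * heat_kernel (4 * T) z.
  move=> /(HC t (z + h)); rewrite dt tT => /(_ isT) /le_trans; apply.
  rewrite -mulrA ler_wpM2l// (_ : 4 * T = 2 * (2 * T)); last by ring.
  by apply: heat_kernel_shift => //; rewrite mulr_gt0.
set w := z + h in shift *; set r := (2 * t)^-1.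
have r0 : 0 <= r by rewrite invr_ge0 mulr_ge0// ltW.
set rho := 1 + (2 * d)^-1 in shift *.
have rrho : r <= rho.
  rewrite -[r]add0r lerD// lef_pV2 ?posrE ?mulr_gt0//.
  by rewrite ler_pM2l.
have rho1 : 1 <= rho by rewrite lerDl invr_ge0 mulr_ge0// ltW.
have mono i j (c : R) : (i <= 4)%N -> (j <= 4)%N -> 0 <= c ->
    `|c * w ^+ i * r ^+ j| <= c * (rho ^+ 4 * (1 + w ^+ 2) ^+ 2).
  move=> i4 j4 c0; rewrite !normrM (ger0_norm c0) -mulrA ler_wpM2l//.
  rewrite mulrC !normrX ler_pM ?exprn_ge0//; last exact: expr_le_sqr.
  rewrite (ger0_norm r0); apply: (@le_trans _ _ (rho ^+ j)).
    by rewrite lerXn2r ?nnegrE// (le_trans r0).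
  by rewrite ler_weXn2l.
set X := rho ^+ 4 * (1 + w ^+ 2) ^+ 2 in shift mono *.
have X0 : 0 <= X by apply: mulr_ge0; exact: exprn_even_ge0.
split.
- rewrite -[heat_kernel t w]mul1r; apply: shift.
  have := mono 0%N 0%N 1 isT isT ler01; rewrite !expr0 !mulr1; lra.
- apply: shift; have := mono 1%N 1%N 1 isT isT ler01.
  rewrite !expr1 mul1r normrN -/r; lra.
- apply: shift; have := mono 2%N 2%N 1 isT isT ler01.
  have := mono 0%N 1%N 1 isT isT ler01; rewrite -/r !expr0 expr1 !mul1r => H1 H2.
  apply: (le_trans (ler_normB _ _)).
  by rewrite exprMn; lra.
- apply: shift; have := mono 3%N 3%N 1 isT isT ler01.
  have := mono 1%N 2%N 3 isT isT (ler0n _ _); rewrite -/r expr1 !mul1r => H1 H2.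
  apply: (le_trans (ler_normD _ _)).
  by rewrite normrN exprMn; lra.
- apply: shift; have := mono 4%N 4%N 1 isT isT ler01.
  have := mono 2%N 3%N 6 isT isT (ler0n _ _).
  have := mono 0%N 2%N 3 isT isT (ler0n _ _).
  rewrite -/r expr0 mulr1 !mul1r => H1 H2 H3.
  apply: (le_trans (ler_normD _ _)); apply: (le_trans (lerD (ler_normB _ _) (lexx _))).
  by rewrite exprMn; lra.
Qed.

(** With [a = |z| / sqrt t], the product [a exp(- a^2 / 8)] is bounded while a second factor
    [exp(- a^2 / 8)] is kept for the kernel at [2 t]. The resulting singularity [t^(-1/2)] is
    integrable, which makes the unshifted Duhamel integral converge. *)
Lemma heat_kernel_dx_le t z : 0 < t ->
  `|heat_kernel_dx t z| <= 2 / Num.sqrt t * heat_kernel (2 * t) z.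
Proof.
move=> t0.
have s0 : 0 < Num.sqrt t by rewrite sqrtr_gt0.
have st : Num.sqrt t ^+ 2 = t by rewrite sqr_sqrtr// ltW.
have s2 : 0 < Num.sqrt 2 :> R by rewrite sqrtr_gt0.
have s2E : (Num.sqrt 2 : R) ^+ 2 = 2 by rewrite sqr_sqrtr.
set p := (Num.sqrt (4 * pi * t))^-1.
have p0 : 0 < p by rewrite invr_gt0 sqrtr_gt0 !mulr_gt0// pi_gt0.
have hk2 : heat_kernel (2 * t) z = p * (Num.sqrt 2)^-1 * expR (- (z ^+ 2 / (8 * t))).
  rewrite /heat_kernel (_ : 4 * pi * (2 * t) = 2 * (4 * pi * t)); last by ring.
  rewrite sqrtrM// invfM mulrC [in RHS]mulrC (mulrC p); congr (expR _ * _).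
  by field; rewrite lt0r_neq0.
have hk1 : heat_kernel t z = p * (expR (- (z ^+ 2 / (8 * t))) * expR (- (z ^+ 2 / (8 * t)))).
  rewrite /heat_kernel -/p -expRD; congr (_ * expR _).
  by field; rewrite lt0r_neq0.
rewrite /heat_kernel_dx normrM normrN (gtr0_norm (heat_kernel_gt0 z t0)).
rewrite normrM normfV (@gtr0_norm _ (2 * t)) ?mulr_gt0// hk1 hk2.
set e := expR _; have e0 : 0 < e by exact: expR_gt0.
set a := `|z| / Num.sqrt t.
have a0 : 0 <= a by rewrite divr_ge0// ltW.
have za : `|z| = a * Num.sqrt t by rewrite divfK// lt0r_neq0.
have e1 : e * (1 + a ^+ 2 / 8) <= 1.
  rewrite /e expRN mulrC ler_pdivrMr ?expR_gt0// mul1r.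
  rewrite (_ : z ^+ 2 / (8 * t) = a ^+ 2 / 8); first exact: expR_ge1Dx.
  rewrite exprMn real_normK ?num_real// exprVn st.
  by field; rewrite lt0r_neq0.
have -> : `|z| / (2 * t) * (p * (e * e)) = (p * e / Num.sqrt t) * (a / 2 * e).
  by rewrite za -{2}st; field; rewrite lt0r_neq0.
have -> : 2 / Num.sqrt t * (p * (Num.sqrt 2)^-1 * e) = (p * e / Num.sqrt t) * (2 / Num.sqrt 2).
  by field; rewrite !lt0r_neq0.
rewrite ler_pM2l ?divr_gt0 ?mulr_gt0//.
have -> : 2 / Num.sqrt 2 = Num.sqrt 2 :> R by rewrite -{1}s2E; field; rewrite lt0r_neq0.
apply: (@le_trans _ _ (Num.sqrt 2 * (e * (1 + a ^+ 2 / 8)))); last first.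
  by rewrite ler_piMr// ltW.
rewrite mulrCA mulrC ler_wpM2l//; first exact: ltW.
have : 0 <= (a - 2 * Num.sqrt 2) ^+ 2 * Num.sqrt 2.
  by rewrite mulr_ge0 ?sqr_ge0// ltW.
rewrite (_ : (a - 2 * Num.sqrt 2) ^+ 2 * Num.sqrt 2 = Num.sqrt 2 * a ^+ 2 - 4 * (Num.sqrt 2) ^+ 2 * a + 4 * Num.sqrt 2 ^+ 2 * Num.sqrt 2); last by ring.
by rewrite s2E; lra.
Qed.

(** Uses [w exp(- w) <= 1] with [w = z^2 / (8 t)]. Integrated, this is the second-moment bound
    behind the convergence of the semigroup to the identity as [t] tends to 0. *)
Lemma sqr_heat_kernel_le t z : 0 < t ->
  z ^+ 2 * heat_kernel t z <= 16 * t * heat_kernel (2 * t) z.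
Proof.
move=> t0.
have s2 : 0 < Num.sqrt 2 :> R by rewrite sqrtr_gt0.
have s2E : (Num.sqrt 2 : R) ^+ 2 = 2 by rewrite sqr_sqrtr.
set p := (Num.sqrt (4 * pi * t))^-1.
have p0 : 0 < p by rewrite invr_gt0 sqrtr_gt0 !mulr_gt0// pi_gt0.
have hk2 : heat_kernel (2 * t) z = p * (Num.sqrt 2)^-1 * expR (- (z ^+ 2 / (8 * t))).
  rewrite /heat_kernel (_ : 4 * pi * (2 * t) = 2 * (4 * pi * t)); last by ring.
  rewrite sqrtrM// invfM mulrC [in RHS]mulrC (mulrC p); congr (expR _ * _).
  by field; rewrite lt0r_neq0.
have hk1 : heat_kernel t z = p * (expR (- (z ^+ 2 / (8 * t))) * expR (- (z ^+ 2 / (8 * t)))).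
  rewrite /heat_kernel -/p -expRD; congr (_ * expR _).
  by field; rewrite lt0r_neq0.
rewrite hk1 hk2.
set e := expR _; have e0 : 0 < e by exact: expR_gt0.
have e1 : e * (z ^+ 2 / (8 * t)) <= 1.
  rewrite /e expRN mulrC ler_pdivrMr ?expR_gt0// mul1r.
  by apply: (le_trans _ (expR_ge1Dx _)); rewrite lerDr.
have -> : z ^+ 2 * (p * (e * e)) = p * e * (8 * t) * (e * (z ^+ 2 / (8 * t))).
  by field; rewrite lt0r_neq0.
have -> : 16 * t * (p * (Num.sqrt 2)^-1 * e) = p * e * (8 * t) * (2 / Num.sqrt 2).
  by field; rewrite lt0r_neq0.
rewrite ler_pM2l ?mulr_gt0//; apply: (le_trans e1).
rewrite ler_pdivlMr// mul1r -[leRHS]ger0_norm// -(sqrtr_sqr 2) ler_sqrt; nra.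
Qed.

End KernelBounds.

(** * Convolution with kernels dominated by a Gaussian *)

Section Convolution.
Variable R : realType.
Notation mu := (@lebesgue_measure R).
Implicit Types (k g : R -> R) (x C M T t : R).

(** Convertible with [heat_sg] and [dx_heat_sg] for the corresponding kernels, so that estimates for
    a general kernel apply to both. *)
Definition kconv k g x : R := Rintegral mu setT (fun y => k (x - y) * g y).

(** As the normal density of mean [x] and variance [2 t], the kernel inherits integrability and
    total mass 1. *)
Lemma heat_kernel_normal_pdf t x y : 0 < t ->
  heat_kernel t (x - y) = normal_pdf x (Num.sqrt (2 * t)) y.
Proof.
move=> t0; have t2 : 0 < 2 * t by rewrite mulr_gt0.
rewrite normal_pdfE ?lt0r_neq0 ?sqrtr_gt0//.
rewrite /heat_kernel /normal_peak /normal_fun sqr_sqrtr; last exact: ltW.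
have -> : 2 * t * pi *+ 2 = 4 * pi * t by rewrite mulr2n; ring.
congr (_ * expR _); rewrite !mulr2n.
have tE : 2 * t + 2 * t = 4 * t by ring.
rewrite tE; congr (_ / _); congr (- _); ring.
Qed.

Lemma integrable_heat_kernel t x : 0 < t ->
  mu.-integrable setT (EFin \o (fun y => heat_kernel t (x - y))).
Proof.
move=> t0; have := integrable_normal_pdf x (Num.sqrt (2 * t)).
by apply: eq_integrable => // y _; rewrite /= heat_kernel_normal_pdf.
Qed.

Lemma Rintegral_heat_kernel t x : 0 < t ->
  Rintegral mu setT (fun y => heat_kernel t (x - y)) = 1.
Proof.
move=> t0; rewrite /Rintegral (_ : 1 = fine (1%E : \bar R))//; congr fine.
rewrite -(integral_normal_pdf x (Num.sqrt (2 * t))).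
by apply: eq_integral => y _; rewrite heat_kernel_normal_pdf.
Qed.

Lemma integrable_kconv k g x C M T : 0 < T -> continuous k -> continuous g ->
  (forall z, `|k z| <= C * heat_kernel T z) -> (forall y, `|g y| <= M) ->
  mu.-integrable setT (EFin \o (fun y => k (x - y) * g y)).
Proof.
move=> T0 kc gc kC gM.
have mk : measurable_fun (setT : set R) (fun y : R => k (x - y) * g y).
  apply: continuous_measurable_fun => y; apply: cvgM; last exact: gc.
  apply: (@continuous_comp _ _ _ (fun y => x - y) k); last exact: kc.
  by apply: cvgB; [exact: cvg_cst|exact: cvg_id].
have intC := integrableZl (measurableT) (C * M) (integrable_heat_kernel x T0).
apply: (le_integrable _ _ _ intC) => //; first exact/measurable_EFinP.
move=> y _ /=; rewrite lee_fin normrM.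
apply: (le_trans _ (ler_norm _)).
rewrite mulrAC ler_pM//.
Qed.

Lemma kconv_le k g x C M T : 0 < T -> continuous k -> continuous g ->
  (forall z, `|k z| <= C * heat_kernel T z) -> (forall y, `|g y| <= M) ->
  `|kconv k g x| <= C * M.
Proof.
move=> T0 kc gc kC gM.
have intk := integrable_kconv x T0 kc gc kC gM.
apply: (le_trans (le_normr_Rintegral _ intk)) => //.
have intC := integrableZl (measurableT) (C * M) (integrable_heat_kernel x T0).
have -> : C * M = Rintegral mu setT (fun y => C * M * heat_kernel T (x - y)).
  by rewrite RintegralZl ?Rintegral_heat_kernel ?mulr1//; exact: integrable_heat_kernel.
apply: le_Rintegral => //.
  exact: (integrable_norm intk).
by move=> y _; rewrite normrM mulrAC ler_pM.
Qed.

(** By linearity, a pointwise Taylor remainder of kernels passes to their convolutions: [k1] is the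
    displaced kernel, [k2] the original one and [k3] its derivative. *)
Lemma kconv_remainder (k1 k2 k3 : R -> R) g x h C1 C2 C3 C M T : 0 < T ->
  continuous k1 -> continuous k2 -> continuous k3 -> continuous g ->
  (forall z, `|k1 z| <= C1 * heat_kernel T z) ->
  (forall z, `|k2 z| <= C2 * heat_kernel T z) ->
  (forall z, `|k3 z| <= C3 * heat_kernel T z) ->
  (forall z, `|k1 z - k2 z - h * k3 z| <= C * heat_kernel T z) ->
  (forall y, `|g y| <= M) ->
  `|kconv k1 g x - kconv k2 g x - h * kconv k3 g x| <= C * M.
Proof.
move=> T0 k1c k2c k3c gc kC1 kC2 kC3 kC gM.
have i1 := integrable_kconv x T0 k1c gc kC1 gM.
have i2 := integrable_kconv x T0 k2c gc kC2 gM.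
have i3 := integrable_kconv x T0 k3c gc kC3 gM.
have i3' := integrableZl (measurableT) h i3.
have kc : continuous (fun z => k1 z - k2 z - h * k3 z).
  move=> z; apply: cvgB; first by apply: cvgB; [exact: k1c|exact: k2c].
  by apply: cvgM; [exact: cvg_cst|exact: k3c].
have -> : kconv k1 g x - kconv k2 g x - h * kconv k3 g x =
    kconv (fun z => k1 z - k2 z - h * k3 z) g x.
  rewrite /kconv -RintegralB// -RintegralZl// -RintegralB//; last exact: (integrableB _ i1 i2).
  by apply: eq_Rintegral => y _ /=; ring.
exact: kconv_le T0 kc gc kC gM.
Qed.

Lemma kconv_diff_fun k g (g' : R -> R) x C M M' T e : 0 < T ->
  continuous k -> continuous g -> continuous g' ->
  (forall z, `|k z| <= C * heat_kernel T z) ->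
  (forall y, `|g y| <= M) -> (forall y, `|g' y| <= M') ->
  (forall y, `|g y - g' y| <= e) ->
  `|kconv k g x - kconv k g' x| <= C * e.
Proof.
move=> T0 kc gc gc' kC gM gM' gg'.
have i1 := integrable_kconv x T0 kc gc kC gM.
have i2 := integrable_kconv x T0 kc gc' kC gM'.
have -> : kconv k g x - kconv k g' x = kconv k (fun y => g y - g' y) x.
  by rewrite /kconv -RintegralB//; apply: eq_Rintegral => y _ /=; ring.
apply: kconv_le T0 kc _ kC gg'.
by move=> y; apply: cvgB; [exact: gc|exact: gc'].
Qed.

Lemma kconv_shift k g x h : kconv k g (x + h) = kconv (fun z => k (z + h)) g x.
Proof. by apply: eq_Rintegral => y _; congr (k _ * _); ring. Qed.

Lemma kconvN k g x C M T : 0 < T -> continuous k -> continuous g ->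
  (forall z, `|k z| <= C * heat_kernel T z) -> (forall y, `|g y| <= M) ->
  kconv k (fun y => - g y) x = - kconv k g x.
Proof.
move=> T0 kc gc kC gM; rewrite -mulN1r -RintegralZl//; last first.
  exact: integrable_kconv T0 kc gc kC gM.
by apply: eq_Rintegral => y _; ring.
Qed.

End Convolution.

(** * Quantitative estimates on the heat semigroup *)

Section HeatSemigroup.
Variable R : realType.
Implicit Types (g : R -> R) (x y z h d s t T M C : R).

Definition dxx_heat_sg t g x : R := kconv (heat_kernel_dxx t) g x.

Lemma continuous_heat_kernel t : 0 < t -> continuous (heat_kernel t).
Proof. by move=> /lt0r_neq0 t0 z; exact: is_derive_cont (is_derive_heat_kernel z t0). Qed.

Lemma continuous_heat_kernel_dx t : 0 < t -> continuous (heat_kernel_dx t).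
Proof. by move=> /lt0r_neq0 t0 z; exact: is_derive_cont (is_derive_heat_kernel_dx z t0). Qed.

Lemma continuous_heat_kernel_dxx t : 0 < t -> continuous (heat_kernel_dxx t).
Proof. by move=> /lt0r_neq0 t0 z; exact: is_derive_cont (is_derive_heat_kernel_dxx z t0). Qed.

Lemma continuous_shift (k : R -> R) h : continuous k -> continuous (fun z => k (z + h)).
Proof.
move=> kc z; apply: (@continuous_comp _ _ _ (fun z => z + h) k); last exact: kc.
by apply: cvgD; [exact: cvg_id|exact: cvg_cst].
Qed.

(** All bounds needed for ages in [[d, T]], with one constant that sees [g] only through [M]. This
    uniformity allows them to be integrated in time when [g] varies along the solution. *)
Definition heat_sg_estimates d T C : Prop :=
  forall g M t x, continuous g -> (forall y, `|g y| <= M) -> d <= t <= T ->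
  [/\ [/\ `|heat_sg t g x| <= C * M,
          `|dx_heat_sg t g x| <= C * M &
          `|dxx_heat_sg t g x| <= C * M],
      forall h, `|h| <= 1 ->
        `|heat_sg t g (x + h) - heat_sg t g x - h * dx_heat_sg t g x|
          <= C * M * h ^+ 2,
      forall h, `|h| <= 1 ->
        `|dx_heat_sg t g (x + h) - dx_heat_sg t g x - h * dxx_heat_sg t g x|
          <= C * M * h ^+ 2,
      forall s, d <= s <= T ->
        `|heat_sg s g x - heat_sg t g x - (s - t) * dxx_heat_sg t g x|
          <= C * M * (s - t) ^+ 2 &
      forall s, d <= s <= T ->
        [/\ `|heat_sg s g x - heat_sg t g x| <= C * M * `|s - t|,
            `|dx_heat_sg s g x - dx_heat_sg t g x| <= C * M * `|s - t| &
            `|dxx_heat_sg s g x - dxx_heat_sg t g x| <= C * M * `|s - t|]].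

Definition heat_sg_stable d T C : Prop :=
  forall g (g' : R -> R) M M' e t x, continuous g -> continuous g' ->
  (forall y, `|g y| <= M) -> (forall y, `|g' y| <= M') ->
  (forall y, `|g y - g' y| <= e) -> d <= t <= T ->
  [/\ `|heat_sg t g x - heat_sg t g' x| <= C * e,
      `|dx_heat_sg t g x - dx_heat_sg t g' x| <= C * e &
      `|dxx_heat_sg t g x - dxx_heat_sg t g' x| <= C * e].

Lemma between_shift z h w : Num.min z (z + h) <= w <= Num.max z (z + h) ->
  `|h| <= 1 -> exists2 h', `|h'| <= 1 & w = z + h'.
Proof.
move=> /andP[w1 w2] h1; exists (w - z); last by ring.
rewrite ler_norml; move: h1 w1 w2; rewrite ler_norml => /andP[h1 h2].
rewrite ge_min le_max => /orP w1 /orP w2.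
by case: w1 => ?; case: w2 => ?; apply/andP; split; lra.
Qed.

Lemma between_itv d T s t w : d <= s <= T -> d <= t <= T ->
  Num.min t s <= w <= Num.max t s -> d <= w <= T.
Proof.
move=> /andP[s1 s2] /andP[t1 t2] /andP[w1 w2].
by rewrite (le_trans _ w1) ?(le_trans w2)// ?le_min ?ge_max ?t1 ?t2.
Qed.

Lemma ex_heat_sg_estimates d T : 0 < d ->
  exists2 C, 0 <= C & heat_sg_estimates d T C /\ heat_sg_stable d T C.
Proof.
move=> d0; have [C C0 HC] := heat_kernel_derivs_bound T d0; exists C => //.
have tpos s : d <= s <= T -> 0 < s by move=> /andP[ds _]; exact: lt_le_trans ds.
have Tpos s : d <= s <= T -> 0 < 4 * T.
  by move=> /[dup] /tpos s0 /andP[_ /(lt_le_trans s0)]; rewrite pmulr_rgt0.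
have HC0 s z : d <= s <= T ->
  [/\ `|heat_kernel s z| <= C * heat_kernel (4 * T) z,
      `|heat_kernel_dx s z| <= C * heat_kernel (4 * T) z,
      `|heat_kernel_dxx s z| <= C * heat_kernel (4 * T) z,
      `|heat_kernel_dxxx s z| <= C * heat_kernel (4 * T) z &
      `|heat_kernel_dxxxx s z| <= C * heat_kernel (4 * T) z].
  by move=> dsT; have := @HC s z 0 dsT; rewrite addr0 normr0; apply.
have kc0 s : d <= s <= T -> continuous (heat_kernel s).
  by move=> /tpos; exact: continuous_heat_kernel.
have kc1 s : d <= s <= T -> continuous (heat_kernel_dx s).
  by move=> /tpos; exact: continuous_heat_kernel_dx.
have kc2 s : d <= s <= T -> continuous (heat_kernel_dxx s).
  by move=> /tpos; exact: continuous_heat_kernel_dxx.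
have kb0 s : d <= s <= T -> forall z, `|heat_kernel s z| <= C * heat_kernel (4 * T) z.
  by move=> dsT z; have [] := HC0 s z dsT.
have kb1 s : d <= s <= T -> forall z, `|heat_kernel_dx s z| <= C * heat_kernel (4 * T) z.
  by move=> dsT z; have [] := HC0 s z dsT.
have kb2 s : d <= s <= T -> forall z, `|heat_kernel_dxx s z| <= C * heat_kernel (4 * T) z.
  by move=> dsT z; have [] := HC0 s z dsT.
split; last first.
  move=> g g' M M' e t x gc gc' gM gM' gg' dtT; have T0 := Tpos _ dtT.
  by split; [apply: kconv_diff_fun T0 (kc0 _ dtT) gc gc' (kb0 _ dtT) gM gM' gg'
    |apply: kconv_diff_fun T0 (kc1 _ dtT) gc gc' (kb1 _ dtT) gM gM' gg'
    |apply: kconv_diff_fun T0 (kc2 _ dtT) gc gc' (kb2 _ dtT) gM gM' gg'].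
move=> g M t x gc gM dtT; have T0 := Tpos _ dtT.
have t0 := tpos _ dtT; have tn0 := lt0r_neq0 t0.
(* Lipschitz bounds in time are the remainder estimate at step 0, where the third kernel is a
   dummy. *)
have lip (k : R -> R -> R) s : d <= s <= T ->
    (forall s, d <= s <= T -> continuous (k s)) ->
    (forall s, d <= s <= T -> forall z, `|k s z| <= C * heat_kernel (4 * T) z) ->
    (forall z, `|k s z - k t z| <= C * heat_kernel (4 * T) z * `|s - t|) ->
    `|kconv (k s) g x - kconv (k t) g x| <= C * M * `|s - t|.
  move=> dsT kc kb kst; rewrite mulrAC.
  have := @kconv_remainder R (k s) (k t) (k t) g x 0 C C C (C * `|s - t|) M _ T0
    (kc _ dsT) (kc _ dtT) (kc _ dtT) gc (kb _ dsT) (kb _ dtT) (kb _ dtT).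
  rewrite mul0r subr0; apply => // z; rewrite mul0r subr0.
  by rewrite mulrAC.
split.
- by split; [apply: kconv_le T0 (kc0 _ dtT) gc (kb0 _ dtT) gM
    |apply: kconv_le T0 (kc1 _ dtT) gc (kb1 _ dtT) gM
    |apply: kconv_le T0 (kc2 _ dtT) gc (kb2 _ dtT) gM].
- move=> h h1; rewrite [heat_sg t g (x + h)](kconv_shift (heat_kernel t)) mulrAC.
  have kbh z : `|heat_kernel t (z + h)| <= C * heat_kernel (4 * T) z.
    by have [] := HC t z h dtT h1.
  apply: (kconv_remainder _ T0 (continuous_shift (kc0 _ dtT)) (kc0 _ dtT) (kc1 _ dtT) gc
     kbh (kb0 _ dtT) (kb1 _ dtT) _ gM).
  move=> z.
  have := @taylor1_of_derive R (heat_kernel t) (heat_kernel_dx t) (heat_kernel_dxx t)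
    (C * heat_kernel (4 * T) z) z (z + h)
    (fun w _ => is_derive_heat_kernel w tn0) (fun w _ => is_derive_heat_kernel_dx w tn0).
  rewrite (_ : z + h - z = h); last by ring.
  rewrite mulrAC; apply => w /between_shift/(_ h1)[h' h'1 ->].
  by have [] := HC t z h' dtT h'1.
- move=> h h1; rewrite [dx_heat_sg t g (x + h)](kconv_shift (heat_kernel_dx t)) mulrAC.
  have kbh z : `|heat_kernel_dx t (z + h)| <= C * heat_kernel (4 * T) z.
    by have [] := HC t z h dtT h1.
  apply: (kconv_remainder _ T0 (continuous_shift (kc1 _ dtT)) (kc1 _ dtT) (kc2 _ dtT) gc
     kbh (kb1 _ dtT) (kb2 _ dtT) _ gM).
  move=> z.
  have := @taylor1_of_derive R (heat_kernel_dx t) (heat_kernel_dxx t) (heat_kernel_dxxx t)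
    (C * heat_kernel (4 * T) z) z (z + h)
    (fun w _ => is_derive_heat_kernel_dx w tn0) (fun w _ => is_derive_heat_kernel_dxx w tn0).
  rewrite (_ : z + h - z = h); last by ring.
  rewrite mulrAC; apply => w /between_shift/(_ h1)[h' h'1 ->].
  by have [] := HC t z h' dtT h'1.
- move=> s dsT; rewrite mulrAC.
  apply: (kconv_remainder _ T0 (kc0 _ dsT) (kc0 _ dtT) (kc2 _ dtT) gc
     (kb0 _ dsT) (kb0 _ dtT) (kb2 _ dtT) _ gM) => z.
  have := @taylor1_of_derive R (fun s => heat_kernel s z) (fun s => heat_kernel_dxx s z)
    (fun s => heat_kernel_dxxxx s z) (C * heat_kernel (4 * T) z) t s.
  rewrite mulrAC; apply => w /(between_itv dsT dtT) dwT.
  + by apply: is_derive_time_heat_kernel; exact: tpos dwT.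
  + by apply: is_derive_time_heat_kernel_dxx; exact: tpos dwT.
  + by have [] := HC0 w z dwT.
- move=> s dsT; split.
  + apply: (lip (@heat_kernel R)) => // z.
    apply: (lipschitz_of_derive (fun s => heat_kernel s z) (fun s => heat_kernel_dxx s z))
      => w /(between_itv dsT dtT) dwT.
      by apply: is_derive_time_heat_kernel; exact: tpos dwT.
    by have [] := HC0 w z dwT.
  + apply: (lip (@heat_kernel_dx R)) => // z.
    apply: (lipschitz_of_derive (fun s => heat_kernel_dx s z) (fun s => heat_kernel_dxxx s z))
      => w /(between_itv dsT dtT) dwT.
      by apply: is_derive_time_heat_kernel_dx; exact: tpos dwT.
    by have [] := HC0 w z dwT.
  + apply: (lip (@heat_kernel_dxx R)) => // z.
    apply: (lipschitz_of_derive (fun s => heat_kernel_dxx s z) (fun s => heat_kernel_dxxxx s z))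
      => w /(between_itv dsT dtT) dwT.
      by apply: is_derive_time_heat_kernel_dxx; exact: tpos dwT.
    by have [] := HC0 w z dwT.
Qed.

Lemma heat_kernel_norm t z : 0 < t -> `|heat_kernel t z| <= 1 * heat_kernel t z.
Proof. by move=> t0; rewrite mul1r gtr0_norm// heat_kernel_gt0. Qed.

Lemma heat_sg_le g M t x : 0 < t -> continuous g -> (forall y, `|g y| <= M) ->
  `|heat_sg t g x| <= M.
Proof.
move=> t0 gc gM; rewrite -[M]mul1r.
apply: (kconv_le _ t0 _ gc _ gM); first exact: continuous_heat_kernel.
by move=> z; exact: heat_kernel_norm.
Qed.

Lemma dx_heat_sg_le g M t x : 0 < t -> continuous g -> (forall y, `|g y| <= M) ->
  `|dx_heat_sg t g x| <= 2 / Num.sqrt t * M.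
Proof.
move=> t0 gc gM.
apply: (@kconv_le _ (heat_kernel_dx t) _ _ _ _ (2 * t) _ _ gc _ gM).
- by rewrite mulr_gt0.
- exact: continuous_heat_kernel_dx.
- by move=> z; exact: heat_kernel_dx_le.
Qed.

(** Chebyshev's argument: for [|y - x| < d] the modulus of continuity gives [e]; elsewhere the
    oscillation is at most [2 M], and inserting [(x - y)^2 / d^2 >= 1] turns the tail into a second
    moment, whose factor [16 t] makes up the 32. *)
Lemma heat_sg_near g M e d t x : 0 < t -> 0 <= e -> 0 < d ->
  continuous g -> (forall y, `|g y| <= M) ->
  (forall y z, `|y - z| < d -> `|g y - g z| <= e) ->
  `|heat_sg t g x - g x| <= e + 32 * M / d ^+ 2 * t.
Proof.
move=> t0 e0 d0 gc gM ge.
have M0 : 0 <= M by apply: le_trans (gM 0).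
have hkc := continuous_heat_kernel t0.
have i1 := integrable_kconv x t0 hkc gc (fun z => heat_kernel_norm z t0) gM.
have i0 := integrable_heat_kernel x t0.
have igx := integrableZl (measurableT) (g x) i0.
have t20 : 0 < 2 * t by rewrite mulr_gt0.
have i2 := integrable_heat_kernel x t20.
have ie := integrableZl (measurableT) e i0.
have i2' := integrableZl (measurableT) (32 * M / d ^+ 2 * t) i2.
have -> : g x = Rintegral lebesgue_measure setT (fun y => g x * heat_kernel t (x - y)).
  by rewrite (RintegralZl _ measurableT i0) Rintegral_heat_kernel// mulr1.
rewrite /heat_sg -(RintegralB measurableT i1 igx).
have -> : e + 32 * M / d ^+ 2 * t = Rintegral lebesgue_measure setT
   (fun y => e * heat_kernel t (x - y) + 32 * M / d ^+ 2 * t * heat_kernel (2 * t) (x - y)).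
  rewrite (RintegralD measurableT ie i2') (RintegralZl _ measurableT i0).
  by rewrite (RintegralZl _ measurableT i2) !Rintegral_heat_kernel// !mulr1.
have ib := integrableB (measurableT) i1 igx.
apply: (le_trans (le_normr_Rintegral _ ib)) => //.
apply: le_Rintegral => //; first exact: (integrable_norm ib).
  exact: (integrableD (measurableT) ie i2').
move=> y _ /=.
have -> : heat_kernel t (x - y) * g y - g x * heat_kernel t (x - y) =
   heat_kernel t (x - y) * (g y - g x) by ring.
have hk0 := heat_kernel_gt0 (x - y) t0.
have hk2 := sqr_heat_kernel_le (x - y) t0.
have hk20 := heat_kernel_gt0 (x - y) t20.
have K0 : 0 <= 32 * M / d ^+ 2 * t * heat_kernel (2 * t) (x - y).
  apply: mulr_ge0; last exact: ltW.
  apply: mulr_ge0; last exact: ltW.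
  by apply: divr_ge0; [exact: mulr_ge0|exact: sqr_ge0].
rewrite normrM (gtr0_norm hk0).
have [yd|dy] := ltP `|y - x| d.
  by rewrite mulrC -[leLHS]addr0 lerD// ler_pM2r// ge.
have gyx : `|g y - g x| <= 2 * M.
  by apply: (le_trans (ler_normB _ _)); have := gM x; have := gM y; lra.
rewrite -[leLHS]add0r; apply: lerD; first by apply: mulr_ge0 => //; exact: ltW.
apply: (le_trans (ler_wpM2l (ltW hk0) gyx)).
have -> : 32 * M / d ^+ 2 * t * heat_kernel (2 * t) (x - y) =
  2 * M / d ^+ 2 * (16 * t * heat_kernel (2 * t) (x - y)).
  by field; rewrite lt0r_neq0.
apply: (le_trans _ (ler_wpM2l _ hk2)); last first.
  by apply: divr_ge0; [exact: mulr_ge0|exact: sqr_ge0].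
have -> : 2 * M / d ^+ 2 * ((x - y) ^+ 2 * heat_kernel t (x - y)) =
  heat_kernel t (x - y) * (2 * M) * ((x - y) ^+ 2 / d ^+ 2).
  by field; rewrite lt0r_neq0.
apply: ler_peMr; first by apply: mulr_ge0; [exact: ltW|exact: mulr_ge0].
rewrite ler_pdivlMr ?exprn_gt0// mul1r.
rewrite -(real_normK (num_real (x - y))) distrC.
by rewrite lerXn2r ?nnegrE// ltW.
Qed.

End HeatSemigroup.

(** * Integrals over segments, with an inverse square root singularity at the end *)

Section IntervalIntegrals.
Variable R : realType.
Notation mu := (@lebesgue_measure R).
Implicit Types (F G : R -> R) (a b c s e r K h : R).

Definition cont_on (A : set R) F : Prop := forall s0, A s0 -> forall e, 0 < e ->
  exists2 r, 0 < r & forall s, A s -> `|s - s0| < r -> `|F s - F s0| <= e.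

Lemma cont_on_within (A : set R) F : cont_on A F -> {within A, continuous F}.
Proof.
move=> cF; apply/subspace_continuousP => s0 As0; apply/cvgrPdist_le => e e0.
have [r r0 Fr] := cF _ As0 _ e0.
rewrite near_withinE; apply/nbhs_ballP; exists r => //= s s0s As.
by rewrite distrC; apply: Fr => //; rewrite distrC.
Qed.

Lemma cont_onS (A B : set R) F : A `<=` B -> cont_on B F -> cont_on A F.
Proof.
move=> AB cF s0 /AB As0 e e0; have [r r0 Fr] := cF _ As0 _ e0.
by exists r => // s /AB; exact: Fr.
Qed.

Lemma cont_on_integrable F a b : cont_on `[a, b] F ->
  mu.-integrable `[a, b] (EFin \o F).
Proof.
move=> /cont_on_within cF.
by apply: continuous_compact_integrable => //; exact: segment_compact.
Qed.

Lemma Rintegral_itv_le F a b K : a <= b ->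
  mu.-integrable `[a, b] (EFin \o F) ->
  (forall s, a <= s <= b -> `|F s| <= K) ->
  `|Rintegral mu `[a, b] F| <= K * (b - a).
Proof.
move=> ab iF FK.
apply: (le_trans (le_normr_Rintegral _ iF)) => //.
have -> : K * (b - a) = Rintegral mu `[a, b] (cst K).
  rewrite Rintegral_cst//= lebesgue_measure_itv/=; congr (K * _).
  by rewrite lte_fin; case: ltP => //= ba; rewrite (@le_anti _ R a b) ?subrr// ab.
apply: le_Rintegral => //.
- exact: (integrable_norm iF).
- by apply: continuous_compact_integrable; [exact: segment_compact|move=> ?; exact: cst_continuous].
Qed.

Lemma Rintegral_itv_remainder (F1 F2 F3 : R -> R) h a b K : a <= b ->
  mu.-integrable `[a, b] (EFin \o F1) ->
  mu.-integrable `[a, b] (EFin \o F2) ->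
  mu.-integrable `[a, b] (EFin \o F3) ->
  (forall s, a <= s <= b -> `|F1 s - F2 s - h * F3 s| <= K) ->
  `|Rintegral mu `[a, b] F1 - Rintegral mu `[a, b] F2 -
    h * Rintegral mu `[a, b] F3| <= K * (b - a).
Proof.
move=> ab i1 i2 i3 FK.
have mab : (R.-ocitv.-measurable).-sigma.-measurable `[a, b]%classic by exact: measurable_itv.
have i12 := integrableB mab i1 i2; have i3' := integrableZl mab h i3.
rewrite -(RintegralB mab i1 i2) -(RintegralZl _ mab i3) -(RintegralB mab i12 i3').
by apply: Rintegral_itv_le => //; exact: (integrableB mab i12 i3').
Qed.

Lemma Rintegral_itv_split F a b c : a <= b -> b <= c ->
  mu.-integrable `[a, c] (EFin \o F) ->
  Rintegral mu `[a, c] F = Rintegral mu `[a, b] F + Rintegral mu `[b, c] F.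
Proof.
move=> ab bc iF.
have := @Rintegral_itvB _ F (BLeft a) (BRight c) b iF.
rewrite !bnd_simp => /(_ ab bc).
rewrite Rintegral_itv_obnd_cbnd; last first.
  by apply: integrableS iF => //; apply: subset_itvr; rewrite bnd_simp.
by move=> <-; ring.
Qed.

(** The added endpoint is a null set. The Duhamel integrand is singular exactly there, and its value
    at that point carries no information. *)
Lemma integrable_itv_closed F a b : a < b -> mu.-integrable `[a, b[ (EFin \o F) ->
  mu.-integrable `[a, b] (EFin \o F).
Proof.
move=> ab /integrableP[mF iF]; apply/integrableP; split.
  rewrite -(@setUitv1 _ _ (BLeft a) b true) ?bnd_simp ?(ltW ab)//; apply/measurable_funU => //.
  by split => //; exact: measurable_fun_set1.
rewrite -integral_itv_bndo_bndc//.
by apply: measurableT_comp.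
Qed.

(** Monotone convergence over segments exhausting [[a, b[], with the primitive [- 2 sqrt (b - s)] on
    each. *)
Lemma integral_inv_sqrt a b : a < b ->
  (\int[mu]_(s in `[a, b[) ((Num.sqrt (b - s))^-1)%:E <= (2 * Num.sqrt (b - a))%:E)%E.
Proof.
move=> ab.
(* The denominator starts at 2 so that [a < c n] already for [n = 0], as the fundamental theorem of
   calculus requires. *)
pose c n := b - (b - a) / n.+2%:R.
have ba0 : 0 < b - a by rewrite subr_gt0.
have cb n : c n < b by rewrite ltrBlDr ltrDl divr_gt0.
have ac n : a < c n.
  rewrite ltrBrDr -ltrBrDl ltr_pdivrMr// ltr_pMr//.
  by rewrite ltr1n.
have sc s n : s <= c n -> 0 < b - s.
  by move=> scn; rewrite subr_gt0 (le_lt_trans scn).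
have dsq s : 0 < b - s -> is_derive s (1:R) (fun s => - (2 * Num.sqrt (b - s)))
    (Num.sqrt (b - s))^-1.
  move=> bs0.
  have d1 : is_derive s (1:R) (fun s => b - s) (-1).
    have /is_derive_eq := is_derive_add (is_derive_cst b s 1) (is_derive_opp (is_derive_id s (1:R))).
    by apply; rewrite add0r.
  have dsqrt : is_derive s (1:R) (fun s => Num.sqrt (b - s)) ((2 * Num.sqrt (b - s))^-1 * -1).
    apply: (@is_derive1_comp R Num.sqrt (fun s => b - s)).
    exact: is_derive1_sqrt.
  is_deriv.
  have := bs0; rewrite -sqrtr_gt0; move: (Num.sqrt _) => w w0.
  by field; rewrite lt0r_neq0.
have cinv s : 0 < b - s -> {for s, continuous (fun s => (Num.sqrt (b - s))^-1)}.
  move=> bs0; apply: cvgV; first by rewrite lt0r_neq0// sqrtr_gt0.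
  apply: (@continuous_comp _ _ _ (fun s => b - s) Num.sqrt); last exact: sqrt_continuous.
  by apply: cvgB; [exact: cvg_cst|exact: cvg_id].
have bigc : `[a, b[%classic = \bigcup_n `[a, c n]%classic.
  apply/seteqP; split => s /=.
    rewrite in_itv/= => /andP[as_ sb].
    have bs : 0 < b - s by rewrite subr_gt0.
    have [n nb] : exists n, (b - a) / (b - s) <= n.+2%:R.
      exists (Num.bound ((b - a) / (b - s))); apply: ltW.
      apply: (lt_trans (archi_boundP _)); first by rewrite divr_ge0// ltW.
      by rewrite ltr_nat.
    exists n => //=; rewrite in_itv/= as_ /= lerBrDr -lerBrDl.
    by rewrite ler_pdivrMr// mulrC -ler_pdivrMr.
  by move=> [n _] /=; rewrite !in_itv/= => /andP[-> /le_lt_trans]; apply.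
rewrite bigc.
have mf n : measurable_fun `[a, c n] (fun s => ((Num.sqrt (b - s))^-1)%:E).
  apply/measurable_EFinP; apply: subspace_continuous_measurable_fun => //.
  apply: continuous_in_subspaceT => s; rewrite inE/= in_itv/= => /andP[_ /sc].
  exact: cinv.
have cvg : (\int[mu]_(s in `[a, c n]) ((Num.sqrt (b - s))^-1)%:E @[n --> \oo] -->
    \int[mu]_(s in (\bigcup_n `[a, c n])%classic) ((Num.sqrt (b - s))^-1)%:E)%E.
  apply: (@ge0_nondecreasing_set_cvg_integral _ (measurableTypeR R) R
    (fun n => `[a, c n]%classic : set (measurableTypeR R)) _ mu) => //.
  - move=> n m nm; apply/subsetPset => s /=; rewrite !in_itv/= => /andP[-> /le_trans]; apply.
    by rewrite lerB// ler_pM2l// lef_pV2 ?posrE// ler_nat.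
apply: (cvge_to_le cvg).
- near=> n.
  rewrite (@continuous_FTC2 _ _ (fun s => - (2 * Num.sqrt (b - s)))) //.
  + by rewrite -EFinB lee_fin opprK addrC lerBlDr lerDl mulr_ge0// sqrtr_ge0.
  + apply: continuous_in_subspaceT => s; rewrite inE/= in_itv/= => /andP[_ /sc].
    exact: cinv.
  + split.
    * by move=> s; rewrite in_itv/= => /andP[_ /ltW/sc/dsq[]].
    * by apply: cvg_at_right_filter; apply: (is_derive_cont (dsq _ ba0)).
    * by apply: cvg_at_left_filter; apply: (is_derive_cont (dsq _ (sc _ _ (lexx _)))).
  + by move=> s; rewrite in_itv/= => /andP[_ /ltW/sc/dsq[_]]; rewrite derive1E.
Unshelve. all: by end_near. Qed.

Lemma singular_integrable F a b K : a < b -> 0 <= K -> cont_on `[a, b[ F ->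
  (forall s, a <= s < b -> `|F s| <= K * (Num.sqrt (b - s))^-1) ->
  mu.-integrable `[a, b] (EFin \o F) /\
  `|Rintegral mu `[a, b] F| <= K * (2 * Num.sqrt (b - a)).
Proof.
move=> ab K0 cF FK.
have mF : measurable_fun `[a, b[ F.
  by apply: subspace_continuous_measurable_fun => //; exact: cont_on_within.
have mq : measurable_fun `[a, b[ (fun s => (Num.sqrt (b - s))^-1).
  apply: subspace_continuous_measurable_fun => //.
  apply: continuous_in_subspaceT => s; rewrite inE/= in_itv/= => /andP[_ sb].
  apply: cvgV; first by rewrite lt0r_neq0// sqrtr_gt0 subr_gt0.
  apply: (@continuous_comp _ _ _ (fun s => b - s) Num.sqrt); last exact: sqrt_continuous.
  by apply: cvgB; [exact: cvg_cst|exact: cvg_id].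
have iq : mu.-integrable `[a, b[ (EFin \o (fun s => (Num.sqrt (b - s))^-1)).
  apply/integrableP; split; first exact/measurable_EFinP.
  apply: le_lt_trans (ltry (2 * Num.sqrt (b - a))).
  apply: le_trans (integral_inv_sqrt ab).
  rewrite le_eqVlt; apply/orP; left; apply/eqP.
  by apply: eq_integral => s _ /=; rewrite ger0_norm// invr_ge0 sqrtr_ge0.
have mab : (R.-ocitv.-measurable).-sigma.-measurable `[a, b[%classic by exact: measurable_itv.
have iKq := integrableZl mab K iq.
have iF : mu.-integrable `[a, b[ (EFin \o F).
  apply: (le_integrable _ _ _ iKq) => //; first exact/measurable_EFinP.
  move=> s /=; rewrite in_itv/= => /FK FKs; rewrite lee_fin.
  by apply: (le_trans FKs); exact: ler_norm.
split; first exact: integrable_itv_closed.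
rewrite -Rintegral_itv_bndo_bndc//.
apply: (le_trans (le_normr_Rintegral _ iF)) => //.
apply: (@le_trans _ _ (Rintegral mu `[a, b[ (fun s => K * (Num.sqrt (b - s))^-1))).
  apply: le_Rintegral => //; first exact: (integrable_norm iF).
rewrite (RintegralZl _ mab iq) ler_wpM2l// /Rintegral.
by have := integral_inv_sqrt ab; case: (integral _ _ _) => [x||] //= _.
Qed.

End IntervalIntegrals.

(** * Regularity of the time-shifted Duhamel integral *)

Section Duhamel.
Variable R : realType.
Notation mu := (@lebesgue_measure R).
Variables (G : R -> R -> R) (T M d C : R).
Hypothesis C0 : 0 <= C.
Hypothesis Gc : forall s, 0 <= s <= T -> continuous (G s).
Hypothesis GM : forall s, 0 <= s <= T -> forall y, `|G s y| <= M.
Hypothesis Gt : forall s0, 0 <= s0 <= T -> forall e, 0 < e -> exists2 r, 0 < r &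
  forall s, 0 <= s <= T -> `|s - s0| < r -> forall y, `|G s y - G s0 y| <= e.
Hypothesis est : heat_sg_estimates d (T + d) C.
Hypothesis stab : heat_sg_stable d (T + d) C.
Implicit Types (t s x h e : R).

(** The age [t + d - s] stays in [[d, t + d]], away from the singularity. Leaving [S] open covers
    the potential and its two space derivatives at once. *)
Definition duhamel (S : R -> (R -> R) -> R -> R) t x : R :=
  Rintegral mu `[0, t] (fun s => S (t + d - s) (G s) x).

(** Lipschitz dependence on the age and on the function: the two properties that make the Duhamel
    integrand continuous in [s]. *)
Let good (S : R -> (R -> R) -> R -> R) :=
  (forall g N s t x, continuous g -> (forall y, `|g y| <= N) ->
    d <= t <= T + d -> d <= s <= T + d -> `|S s g x - S t g x| <= C * N * `|s - t|) /\
  (forall g (g' : R -> R) N N' e t x, continuous g -> continuous g' ->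
    (forall y, `|g y| <= N) -> (forall y, `|g' y| <= N') ->
    (forall y, `|g y - g' y| <= e) -> d <= t <= T + d ->
    `|S t g x - S t g' x| <= C * e).

Let good0 : good (@heat_sg R).
Proof.
split=> [g N s t x gc gN dt ds|g g' N N' e t x gc gc' gN gN' gg' dt].
  by have [_ _ _ _ /(_ _ ds)[]] := est x gc gN dt.
by have [] := stab x gc gc' gN gN' gg' dt.
Qed.

Let good1 : good (@dx_heat_sg R).
Proof.
split=> [g N s t x gc gN dt ds|g g' N N' e t x gc gc' gN gN' gg' dt].
  by have [_ _ _ _ /(_ _ ds)[]] := est x gc gN dt.
by have [] := stab x gc gc' gN gN' gg' dt.
Qed.

Let good2 : good (@dxx_heat_sg R).
Proof.
split=> [g N s t x gc gN dt ds|g g' N N' e t x gc gc' gN gN' gg' dt].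
  by have [_ _ _ _ /(_ _ ds)[]] := est x gc gN dt.
by have [] := stab x gc gc' gN gN' gg' dt.
Qed.

Let M0 s : 0 <= s <= T -> 0 <= M.
Proof. by move=> /GM/(_ 0); exact: le_trans. Qed.

Let rangeP t s : 0 <= t <= T -> 0 <= s <= t -> d <= t + d - s <= T + d.
Proof. by move=> /andP[? ?] /andP[? ?]; apply/andP; split; lra. Qed.

Let sT t s : 0 <= t <= T -> 0 <= s <= t -> 0 <= s <= T.
Proof. by move=> /andP[? ?] /andP[? ?]; apply/andP; split; lra. Qed.

Let duhamel_cont S t x : good S -> 0 <= t <= T ->
  cont_on `[0, t] (fun s => S (t + d - s) (G s) x).
Proof.
move=> [lip stb] tT s0 /=; rewrite in_itv/= => s0t e e0.
have s0T := sT tT s0t; have M0' := M0 s0T.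
have C1 : 0 < 2 * (C + 1) by rewrite mulr_gt0// ltr_wpDl.
have CM0 : 0 <= C * M by rewrite mulr_ge0.
have CM1 : 0 < 2 * (C * M + 1) by rewrite mulr_gt0// ltr_wpDl.
have [r r0 Gr] := Gt s0T (divr_gt0 e0 C1).
exists (Num.min r (e / (2 * (C * M + 1)))); first by rewrite lt_min r0 divr_gt0.
move=> s; rewrite /= in_itv/= => st; rewrite lt_min => /andP[sr ss0].
have sT' := sT tT st.
have := stb _ _ _ _ _ _ x (Gc sT') (Gc s0T) (GM sT') (GM s0T) (Gr _ sT' sr) (rangeP tT s0t).
have := lip _ _ _ _ x (Gc sT') (GM sT') (rangeP tT s0t) (rangeP tT st).
rewrite (_ : t + d - s - (t + d - s0) = s0 - s); last by ring.
rewrite distrC -[`|s0 - s|]distrC => h1 h2.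
rewrite (_ : _ - _ = (S (t + d - s) (G s) x - S (t + d - s0) (G s) x) +
   (S (t + d - s0) (G s) x - S (t + d - s0) (G s0) x)); last by ring.
apply: (le_trans (ler_normD _ _)).
rewrite [leRHS](_ : e = e / 2 + e / 2); last by field.
apply: lerD.
  rewrite distrC; apply: (le_trans h1); rewrite [leRHS](_ : _ = (C * M + 1) * (e / (2 * (C * M + 1)))).
    by apply: ler_pM => //; [rewrite lerDl|exact: ltW].
  by field; rewrite lt0r_neq0// ltr_wpDl.
apply: (le_trans h2); rewrite [leRHS](_ : _ = (C + 1) * (e / (2 * (C + 1)))).
  by rewrite ler_wpM2r ?lerDl// divr_ge0// ltW.
by field; rewrite lt0r_neq0// ltr_wpDl.
Qed.

Let duhamel_int S t x : good S -> 0 <= t <= T ->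
  mu.-integrable `[0, t] (EFin \o (fun s => S (t + d - s) (G s) x)).
Proof. by move=> gS tT; apply: cont_on_integrable; exact: duhamel_cont. Qed.

Lemma is_derive_duhamel t x : 0 <= t <= T ->
  is_derive x (1:R) (duhamel (@heat_sg R) t) (duhamel (@dx_heat_sg R) t x).
Proof.
move=> tT; apply: (@is_derive_of_remainder _ _ _ _ (C * M * t)) => h h1.
rewrite (_ : C * M * t * h ^+ 2 = C * M * h ^+ 2 * (t - 0)); last by ring.
apply: (@Rintegral_itv_remainder _ _ _ _ h).
- by case/andP: tT.
- exact: (duhamel_int _ good0 tT).
- exact: (duhamel_int _ good0 tT).
- exact: (duhamel_int _ good1 tT).
- move=> s st; have sT' := sT tT st.
  by have [_ H _ _ _] := est x (Gc sT') (GM sT') (rangeP tT st); exact: H.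
Qed.

Lemma is_derive_dx_duhamel t x : 0 <= t <= T ->
  is_derive x (1:R) (duhamel (@dx_heat_sg R) t) (duhamel (@dxx_heat_sg R) t x).
Proof.
move=> tT; apply: (@is_derive_of_remainder _ _ _ _ (C * M * t)) => h h1.
rewrite (_ : C * M * t * h ^+ 2 = C * M * h ^+ 2 * (t - 0)); last by ring.
apply: (@Rintegral_itv_remainder _ _ _ _ h).
- by case/andP: tT.
- exact: (duhamel_int _ good1 tT).
- exact: (duhamel_int _ good1 tT).
- exact: (duhamel_int _ good2 tT).
- move=> s st; have sT' := sT tT st.
  by have [_ _ H _ _] := est x (Gc sT') (GM sT') (rangeP tT st); exact: H.
Qed.

Lemma dx_duhamel_le t x : 0 <= t <= T -> `|duhamel (@dx_heat_sg R) t x| <= C * M * T.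
Proof.
move=> tT; have /andP[t0 tT'] := tT.
apply: (@le_trans _ _ (C * M * (t - 0))).
  apply: Rintegral_itv_le => //; first exact: (duhamel_int _ good1 tT).
  move=> s st; have sT' := sT tT st.
  by have [[_ H _] _ _ _ _] := est x (Gc sT') (GM sT') (rangeP tT st).
by rewrite subr0 ler_wpM2l// mulr_ge0// (M0 tT).
Qed.

Let shrink t h s : 0 <= h <= t -> 0 <= s <= t - h -> 0 <= s <= t.
Proof. by move=> /andP[? ?] /andP[? ?]; apply/andP; split; lra. Qed.

Let tail t h s : 0 <= h <= t -> t - h <= s <= t -> 0 <= s <= t.
Proof. by move=> /andP[? ?] /andP[? ?]; apply/andP; split; lra. Qed.

Let duhamel_split S t h x : good S -> 0 <= t <= T -> 0 <= h <= t ->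
  [/\ duhamel S t x = Rintegral mu `[0, t - h] (fun s => S (t + d - s) (G s) x) +
                      Rintegral mu `[t - h, t] (fun s => S (t + d - s) (G s) x),
    mu.-integrable `[0, t - h] (EFin \o (fun s => S (t + d - s) (G s) x)),
    mu.-integrable `[t - h, t] (EFin \o (fun s => S (t + d - s) (G s) x)) &
    mu.-integrable `[0, t - h] (EFin \o (fun s => S (t - h + d - s) (G s) x))].
Proof.
move=> gS tT ht; have /andP[h0 ht'] := ht; have iF := duhamel_int x gS tT.
split.
- by apply: Rintegral_itv_split => //; [rewrite subr_ge0|rewrite gerBl].
- by apply: integrableS iF => // s /=; rewrite !in_itv/=; exact: shrink.
- by apply: integrableS iF => // s /=; rewrite !in_itv/=; exact: tail.
- apply: duhamel_int => //.
  by apply: (sT tT); rewrite subr_ge0 ht' gerBl.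
Qed.

(** Leibniz rule: the moving endpoint contributes the semigroup at age [d], the integrand its second
    space derivative. Only backward differences appear, since the maximum principle compares with
    earlier times. *)
Lemma duhamel_time_derivative t x e : 0 < t <= T -> 0 < e ->
  exists2 r, 0 < r & forall h, 0 < h < r -> h <= t ->
  `|duhamel (@heat_sg R) t x - duhamel (@heat_sg R) (t - h) x -
    h * (heat_sg d (G t) x + duhamel (@dxx_heat_sg R) t x)| <= e * h.
Proof.
move=> /andP[t0 tT'] e0; have tT : 0 <= t <= T by rewrite (ltW t0).
have tt : 0 <= t <= t by rewrite (ltW t0) lexx.
have tin : `[0, t]%classic t by rewrite /= in_itv/=.
have CM0 : 0 <= C * M by rewrite mulr_ge0// (M0 tT).
have T0 : 0 < T by exact: lt_le_trans tT'.
have e2 : 0 < e / 2 by rewrite divr_gt0.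
have [r r0 Hr] := duhamel_cont x good0 tT tin e2.
have K0 : 0 < C * M * T + C * M + 1 by rewrite ltr_wpDl// addr_ge0// mulr_ge0// ltW.
exists (Num.min r (e / 2 / (C * M * T + C * M + 1))); first by rewrite lt_min r0 divr_gt0.
move=> h /andP[h0]; rewrite lt_min => /andP[hr hK] ht.
have h0t : 0 <= h <= t by rewrite (ltW h0).
have [E0 i1 i2 i3] := duhamel_split x good0 tT h0t.
have [E2 j1 j2 _] := duhamel_split x good2 tT h0t.
have th0 : 0 <= t - h by rewrite subr_ge0.
have first_part := Rintegral_itv_remainder (K := C * M * h ^+ 2) (h := h) th0 i1 i3 j1.
have /first_part {}first_part : forall s, 0 <= s <= t - h ->
    `|heat_sg (t + d - s) (G s) x - heat_sg (t - h + d - s) (G s) x -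
      h * dxx_heat_sg (t + d - s) (G s) x| <= C * M * h ^+ 2.
  move=> s sth; have st := shrink h0t sth; have sT' := sT tT st.
  have [_ _ _ H _] := est x (Gc sT') (GM sT') (rangeP tT st).
  have thT : 0 <= t - h <= T by apply: (sT tT); rewrite th0 gerBl ltW.
  have := H _ (rangeP thT sth).
  rewrite (_ : t - h + d - s - (t + d - s) = - h); last by ring.
  by rewrite sqrrN mulNr opprK -normrN; congr (_ <= _); congr `|_|; ring.
have ic : mu.-integrable `[t - h, t] (EFin \o cst (heat_sg d (G t) x)).
  by apply: continuous_compact_integrable; [exact: segment_compact|move=> ?; exact: cst_continuous].
have tht : t - h <= t by rewrite gerBl ltW.
(* On the short piece the integrand is within [e / 2] of its value at [s = t]; the second-derivative
   term removed here contributes only order [h^2]. *)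
have second_part := Rintegral_itv_remainder (K := e / 2 + h * (C * M)) (h := h) tht i2 ic j2.
have /second_part {}second_part : forall s, t - h <= s <= t ->
    `|heat_sg (t + d - s) (G s) x - cst (heat_sg d (G t) x) s -
      h * dxx_heat_sg (t + d - s) (G s) x| <= e / 2 + h * (C * M).
  move=> s sth; have st := tail h0t sth; have sT' := sT tT st.
  apply: (le_trans (ler_normB _ _)); apply: lerD.
    have := Hr s; rewrite /= in_itv/= => /(_ st).
    rewrite (_ : t + d - t = d); last by ring.
    apply; move: sth => /andP[sh1 sh2].
    by rewrite ler0_norm ?subr_le0// opprB (le_lt_trans _ hr)// lerBlDr -lerBlDl.
  rewrite normrM (gtr0_norm h0) ler_wpM2l ?(ltW h0)//.
  by have [[_ _ H] _ _ _ _] := est x (Gc sT') (GM sT') (rangeP tT st).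
have cstE : Rintegral mu `[t - h, t] (cst (heat_sg d (G t) x)) = heat_sg d (G t) x * h.
  rewrite Rintegral_cst//= lebesgue_measure_itv/= lte_fin ltrBlDr ltrDl h0.
  by rewrite -EFinB/=; congr (_ * _); ring.
rewrite cstE in second_part.
rewrite E0 E2.
set I1 := Rintegral mu `[0, t - h] _ in first_part *.
set I2 := Rintegral mu `[t - h, t] _ in second_part *.
set J1 := Rintegral mu `[0, t - h] (fun s => dxx_heat_sg _ _ _) in first_part *.
set J2 := Rintegral mu `[t - h, t] (fun s => dxx_heat_sg _ _ _) in second_part *.
have {}first_part : `|I1 - duhamel (@heat_sg R) (t - h) x - h * J1| <= C * M * h ^+ 2 * (t - h - 0).
  exact: first_part.
have {}second_part : `|I2 - heat_sg d (G t) x * h - h * J2| <= (e / 2 + h * (C * M)) * (t - (t - h)).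
  exact: second_part.
rewrite (_ : _ - _ = (I1 - duhamel (@heat_sg R) (t - h) x - h * J1) +
   (I2 - heat_sg d (G t) x * h - h * J2)); last by ring.
apply: (le_trans (ler_normD _ _)); apply: (le_trans (lerD first_part second_part)).
rewrite [leLHS](_ : _ = (e / 2 + h * (C * M * (t - h) + C * M)) * h); last by ring.
rewrite ler_wpM2r ?(ltW h0)// -lerBrDl (_ : e - e / 2 = e / 2); last by field.
apply: (@le_trans _ _ (h * (C * M * T + C * M + 1))); last first.
  by rewrite -ler_pdivlMr// ltW.
rewrite ler_wpM2l ?(ltW h0)//.
have : C * M * (t - h) <= C * M * T by rewrite ler_wpM2l// lerBlDr (le_trans tT')// lerDl ltW.
lra.
Qed.

Lemma duhamel_time_lipschitz s t x : 0 <= s <= t -> 0 <= t <= T ->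
  `|duhamel (@heat_sg R) t x - duhamel (@heat_sg R) s x| <=
    (C * M * T + C * M) * (t - s).
Proof.
move=> /andP[s0 st] tT; have /andP[t0 tT'] := tT.
have ht : 0 <= t - s <= t by rewrite subr_ge0 st gerBl.
have [E0 i1 i2 i3] := duhamel_split x good0 tT ht.
have tsE : t - (t - s) = s by ring.
rewrite tsE in E0 i1 i2 i3.
have CM0 : 0 <= C * M by rewrite mulr_ge0// (M0 tT).
have sT' : 0 <= s <= T by rewrite s0 (le_trans st).
rewrite E0.
set I1 := Rintegral mu `[0, s] _; set I2 := Rintegral mu `[s, t] _.
(* The factor 0 makes this plain difference an instance of the remainder lemma. *)
have h1 : `|I1 - duhamel (@heat_sg R) s x - 0 * I1| <= C * M * (t - s) * (s - 0).
  apply: (Rintegral_itv_remainder s0 i1 i3 i1) => w ws.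
  have wt : 0 <= w <= t by move: ws => /andP[-> /le_trans]; apply.
  have wT := sT tT wt.
  have := good0.1 _ _ _ _ x (Gc wT) (GM wT) (rangeP sT' ws) (rangeP tT wt).
  rewrite mul0r subr0 (_ : t + d - w - (s + d - w) = t - s); last by ring.
  by have ts0 : 0 <= t - s; [rewrite subr_ge0|rewrite (ger0_norm ts0)].
have h2 : `|I2| <= C * M * (t - s).
  apply: Rintegral_itv_le => // w /andP[sw wt].
  have wt' : 0 <= w <= t by rewrite wt (le_trans s0).
  have wT := sT tT wt'.
  by have [[H _ _] _ _ _ _] := est x (Gc wT) (GM wT) (rangeP tT wt').
rewrite mul0r subr0 in h1.
rewrite (_ : _ - _ = I1 - duhamel (@heat_sg R) s x + I2); last by ring.
apply: (le_trans (ler_normD _ _)); apply: (le_trans (lerD h1 h2)).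
rewrite subr0 mulrDl lerD2r mulrAC ler_wpM2r ?subr_ge0//.
by rewrite ler_wpM2l// (le_trans st).
Qed.

End Duhamel.

(** * First- and second-order conditions at a local minimum *)

Section LocalMinima.
Variable R : realType.
Implicit Types (F dF : R -> R) (x h l e r : R).

Lemma is_derive_linear_approx F x l e : is_derive x (1:R) F l -> 0 < e ->
  exists2 r, 0 < r & forall h, `|h| < r -> `|F (x + h) - F x - h * l| <= e * `|h|.
Proof.
move=> [dF Fl] e0.
have : h^-1 *: (F (h *: (1:R) + x) - F x) @[h --> 0^'] --> l.
  by rewrite -Fl; exact: dF.
move=> /cvgrPdist_le/(_ _ e0)[/= r r0 Hr]; exists r => // h hr.
have [->|h0] := eqVneq h 0; first by rewrite addr0 subrr mul0r subrr normr0 mulr0.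
have := Hr h; rewrite /= sub0r normrN => /(_ hr h0).
rewrite /GRing.scale/= mulr1 (addrC h) => {}Hr.
rewrite (_ : _ - h * l = - (h * (l - h^-1 * (F (x + h) - F x)))); last by field.
by rewrite normrN normrM mulrC ler_wpM2r.
Qed.

Lemma local_min_derive0 F x l r : 0 < r -> is_derive x (1:R) F l ->
  (forall h, `|h| < r -> F x <= F (x + h)) -> l = 0.
Proof.
move=> r0 Fl Fmin; apply/eqP/negPn/negP => l0.
have l2 : 0 < `|l| / 2 by rewrite divr_gt0// normr_gt0.
have [r' r'0 Hr'] := is_derive_linear_approx Fl l2.
pose m := Num.min r r' / 2.
have m0 : 0 < m by rewrite divr_gt0// lt_min r0.
have mr : m < Num.min r r' by rewrite ltr_pdivrMr// ltr_pMr// ?ltr1n// lt_min r0.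
have [mr1 mr2] : m < r /\ m < r' by move: mr; rewrite lt_min => /andP.
pose h := - Num.sg l * m.
have hm : `|h| = m by rewrite normrM normrN normr_sg l0 mul1r gtr0_norm.
have := Fmin h; rewrite hm => /(_ mr1) F1.
have := Hr' h; rewrite hm => /(_ mr2); rewrite ler_norml => /andP[_].
have -> : h * l = - (`|l| * m) by rewrite /h normrEsg; ring.
have : 0 < `|l| * m by rewrite mulr_gt0// normr_gt0.
by lra.
Qed.

(** If [l < 0], then [dF], which vanishes at [x], is negative just to the right of it, and the mean
    value theorem makes [F] drop below [F x]. *)
Lemma local_min_second_derive F dF x l r : 0 < r ->
  (forall h, `|h| < r -> is_derive (x + h) (1:R) F (dF (x + h))) ->
  is_derive x (1:R) dF l ->
  (forall h, `|h| < r -> F x <= F (x + h)) -> 0 <= l.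
Proof.
move=> r0 FdF dFl Fmin; rewrite leNgt; apply/negP => l0.
have dF0 : dF x = 0.
  by apply: (local_min_derive0 r0 _ Fmin); have := FdF 0; rewrite addr0 normr0; exact.
have l2 : 0 < - l / 2 by rewrite divr_gt0// oppr_gt0.
have [r' r'0 Hr'] := is_derive_linear_approx dFl l2.
pose m := Num.min r r' / 2.
have m0 : 0 < m by rewrite divr_gt0// lt_min r0.
have mr : m < Num.min r r' by rewrite ltr_pdivrMr// ltr_pMr// ?ltr1n// lt_min r0.
have [mr1 mr2] : m < r /\ m < r' by move: mr; rewrite lt_min => /andP.
have xm : x < x + m by rewrite ltrDl.
have FdF' w : x <= w <= x + m -> is_derive w (1:R) F (dF w).
  move=> /andP[w1 w2]; rewrite -(subrKC x w).
  by apply: FdF; rewrite ger0_norm ?subr_ge0//; lra.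
have cF : {within `[x, x + m], continuous F}.
  apply: continuous_in_subspaceT => w; rewrite inE/= in_itv/= => /FdF'.
  exact: is_derive_cont.
have FdF2 w : w \in `]x, (x + m)[ -> is_derive w (1:R) F (dF w).
  by rewrite in_itv/= => /andP[/ltW w1 /ltW w2]; apply: FdF'; rewrite w1.
have [w] := MVT xm FdF2 cF.
rewrite in_itv/= => /andP[w1 w2] E.
have h0 : 0 < w - x by rewrite subr_gt0.
have := Hr' (w - x); rewrite (gtr0_norm h0) subrKC dF0 subr0 => Hw.
have /Hw : w - x < r' by lra.
rewrite ler_norml => /andP[_ dFw].
have dFneg : dF w < 0.
  have : (w - x) * l < 0 by rewrite pmulr_rlt0.
  by lra.
have := Fmin m; rewrite gtr0_norm// => /(_ mr1).
have : dF w * (x + m - x) < 0 by rewrite nmulr_rlt0// (_ : x + m - x = m)//; ring.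
by lra.
Qed.

End LocalMinima.

(** * The barrier and its differential inequality *)

Section ModulusPrinciple.
Variable R : realType.
Implicit Types (t x y z h e r : R).

Definition barrier (b A t z : R) : R :=
  b * z - A * z * ((1 + t)^-1 * expR (- (z ^+ 2) / (16 * (1 + t)))).

Definition barrier_dz (b A t z : R) : R :=
  b - A * (1 - z ^+ 2 / (8 * (1 + t))) *
    ((1 + t)^-1 * expR (- (z ^+ 2) / (16 * (1 + t)))).

Definition barrier_dzz (A t z : R) : R :=
  A * (3 * z / (8 * (1 + t)) - z ^+ 3 / (64 * (1 + t) ^+ 2)) *
    ((1 + t)^-1 * expR (- (z ^+ 2) / (16 * (1 + t)))).

Definition barrier_dt (A t z : R) : R :=
  A * z * ((1 + t)^-1 - z ^+ 2 / (16 * (1 + t) ^+ 2)) *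
    ((1 + t)^-1 * expR (- (z ^+ 2) / (16 * (1 + t)))).

Lemma is_derive_barrier b A t z : 0 <= t ->
  is_derive z (1:R) (barrier b A t) (barrier_dz b A t z).
Proof.
move=> t0; have t1 : 1 + t != 0 by rewrite lt0r_neq0// ltr_pwDl.
by rewrite /barrier; is_deriv; rewrite /barrier_dz; field.
Qed.

Lemma is_derive_barrier_dz b A t z : 0 <= t ->
  is_derive z (1:R) (barrier_dz b A t) (barrier_dzz A t z).
Proof.
move=> t0; have t1 : 1 + t != 0 by rewrite lt0r_neq0// ltr_pwDl.
by rewrite /barrier_dz; is_deriv; rewrite /barrier_dzz; field.
Qed.

Lemma is_derive_barrier_time b A t z : 0 <= t ->
  is_derive t (1:R) (fun t => barrier b A t z) (barrier_dt A t z).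
Proof.
move=> t0; have t1 : 1 + t != 0 by rewrite lt0r_neq0// ltr_pwDl.
rewrite /barrier; is_deriv; rewrite ?mulf_neq0//.
by rewrite /barrier_dt; field.
Qed.

(** The difference of the two sides is exactly [1 / (2 (1+t))] times the subtracted dipole term, the
    trace of the exponent -1 in place of -3/2. Its sign is that of [z]. *)
Lemma barrier_subsolution A t z : 0 <= A -> 0 <= t -> 0 <= z ->
  barrier_dt A t z <= 4 * barrier_dzz A t z.
Proof.
move=> A0 t0 z0; have t1 : 0 < 1 + t by rewrite ltr_pwDl.
rewrite -subr_ge0 [X in 0 <= X](_ : _ = A * z * (2 * (1 + t))^-1 *
    ((1 + t)^-1 * expR (- (z ^+ 2) / (16 * (1 + t))))).
  by rewrite !mulr_ge0 ?expR_ge0 ?invr_ge0 ?mulr_ge0// ltW.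
by rewrite /barrier_dt /barrier_dzz; field; rewrite lt0r_neq0.
Qed.

Lemma barrier_le b A t z : 0 <= A -> 0 <= t -> 0 <= z -> barrier b A t z <= b * z.
Proof.
move=> A0 t0 z0; rewrite gerBl !mulr_ge0 ?expR_ge0 ?invr_ge0//.
by rewrite addr_ge0.
Qed.

End ModulusPrinciple.

(** * Maximum principle in doubled space variables *)

Section MaximumPrinciple.
Variable R : realType.
(** [U] and [V] are the first two space derivatives of [Phi], and [H] is the smoothed forcing. The
    flux enters only through [H_ge], which says that [H] is within [r] of an [L]-Lipschitz function
    of [U]. *)
Variables (Phi U V H : R -> R -> R) (T M L r b A K : R).
Hypothesis T0 : 0 <= T.
Hypothesis L0 : 0 <= L.
Hypothesis A0 : 0 <= A.
Hypothesis r0 : 0 <= r.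
Hypothesis dPhi : forall t x, 0 <= t <= T -> is_derive x (1:R) (Phi t) (U t x).
Hypothesis dU : forall t x, 0 <= t <= T -> is_derive x (1:R) (U t) (V t x).
Hypothesis Phi_t : forall t x y e, 0 < t <= T -> 0 < e -> exists2 d, 0 < d &
  forall h, 0 < h < d -> h <= t ->
  `|(Phi t x - Phi t y) - (Phi (t - h) x - Phi (t - h) y) -
    h * ((V t x + H t x) - (V t y + H t y))| <= e * h.
Hypothesis Phi_lip : forall s t x, 0 <= s <= T -> 0 <= t <= T ->
  `|Phi s x - Phi t x| <= K * (1 + `|x|) * `|s - t|.
Hypothesis U_le : forall t x, 0 <= t <= T -> `|U t x| <= M.
Hypothesis H_ge : forall t x y, 0 <= t <= T ->
  - (L * `|U t x - U t y| + 2 * r) <= H t x - H t y.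
Hypothesis Phi0 : forall x y, y <= x -> barrier b A 0 (x - y) <= Phi 0 x - Phi 0 y.
Implicit Types (t x y z h e rho : R).

Let Phi_lipx t x y : 0 <= t <= T -> `|Phi t x - Phi t y| <= M * `|x - y|.
Proof.
by move=> tT; apply: (lipschitz_of_derive (Phi t) (U t)) => w _; [exact: dPhi|exact: U_le].
Qed.

Let M0 : 0 <= M.
Proof. by apply: le_trans (U_le 0 (_ : 0 <= 0 <= T)) => //; rewrite lexx. Qed.

Let Phi_cvg (X : Type) (F : set_system X) (tau xi : X -> R) t x : Filter F ->
  (\forall p \near F, 0 <= tau p <= T) -> 0 <= t <= T ->
  tau p @[p --> F] --> t -> xi p @[p --> F] --> x ->
  Phi (tau p) (xi p) @[p --> F] --> Phi t x.
Proof.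
move=> FF tauT tT tau_t xi_x; apply/cvgrPdist_le => e e0.
pose c := `|K| * (1 + `|x|) + M + 1.
have c0 : 0 < c.
  by rewrite ltr_wpDl// addr_ge0// mulr_ge0// addr_ge0.
have ec : 0 < e / c by rewrite divr_gt0.
move/cvgrPdist_le/(_ _ ec) : tau_t => tau_t.
move/cvgrPdist_le/(_ _ ec) : xi_x => xi_x.
near=> p.
have tpT : 0 <= tau p <= T by near: p.
have tp : `|t - tau p| <= e / c by near: p.
have xp : `|x - xi p| <= e / c by near: p.
rewrite (_ : _ - _ = (Phi t x - Phi (tau p) x) + (Phi (tau p) x - Phi (tau p) (xi p))); last by ring.
apply: (le_trans (ler_normD _ _)).
have h1 : `|Phi t x - Phi (tau p) x| <= `|K| * (1 + `|x|) * (e / c).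
  apply: (le_trans (Phi_lip _ tT tpT)).
  apply: (@le_trans _ _ (`|K| * (1 + `|x|) * `|t - tau p|)).
    by rewrite -!mulrA ler_wpM2r ?ler_norm// mulr_ge0// addr_ge0.
  by rewrite ler_wpM2l// mulr_ge0// addr_ge0.
have h2 : `|Phi (tau p) x - Phi (tau p) (xi p)| <= M * (e / c).
  by apply: (le_trans (Phi_lipx _ _ tpT)); rewrite ler_wpM2l.
apply: (le_trans (lerD h1 h2)); rewrite -mulrDl.
have e1 : c * (e / c) = e by field; rewrite lt0r_neq0.
by rewrite -[leRHS]e1 ler_wpM2r ?(ltW ec)// lerDl.
Unshelve. all: by end_near. Qed.

Section Penalized.
Variable eps : R.
Hypothesis eps0 : 0 < eps.

(** Of the growth rate, 4 pays for the second derivative of the penalty along [(1,-1)], [2 L] for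
    the mismatch of the two slopes, and 1 makes the contradiction strict. *)
Let c : R := 5 + 2 * L.

(** The [eps] term forces positivity far away, on the diagonal and at time 0; the term [2 r t]
    compensates the error in the forcing. *)
Let Z t x y : R := Phi t x - Phi t y +
  (eps * expR (c * t) * (1 + x ^+ 2 + y ^+ 2) + 2 * r * t - barrier b A t (x - y)).

Let Z_cvg (X : Type) (F : set_system X) (tau xi ups : X -> R) t x y : Filter F ->
  (\forall p \near F, 0 <= tau p <= T) -> 0 <= t <= T ->
  tau p @[p --> F] --> t -> xi p @[p --> F] --> x -> ups p @[p --> F] --> y ->
  Z (tau p) (xi p) (ups p) @[p --> F] --> Z t x y.
Proof.
move=> FF tauT tT ct cx cy.
apply: cvgD; first by apply: cvgB; exact: Phi_cvg.
have t1 : 1 + t != 0 by move: tT => /andP[t0 _]; rewrite lt0r_neq0// ltr_pwDl.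
have cexp (Y : Type) (G : set_system Y) (f : Y -> R) (l : R) : Filter G ->
    f p @[p --> G] --> l -> expR (f p) @[p --> G] --> expR l.
  by move=> FG fl; apply: (cvg_comp _ expR fl); exact: continuous_expR.
have csq (Y : Type) (G : set_system Y) (f : Y -> R) (l : R) : Filter G ->
    f p @[p --> G] --> l -> f p ^+ 2 @[p --> G] --> l ^+ 2.
  by move=> FG fl; rewrite expr2; apply: cvgM.
have cxy : xi p - ups p @[p --> F] --> x - y by apply: cvgB.
have c1t : 1 + tau p @[p --> F] --> 1 + t by apply: cvgD => //; exact: cvg_cst.
apply: cvgB.
  apply: cvgD; last by apply: cvgM => //; exact: cvg_cst.
  apply: cvgM.
    apply: cvgM; first exact: cvg_cst.
    by apply: cexp; apply: cvgM => //; exact: cvg_cst.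
  by apply: cvgD; [apply: cvgD; [exact: cvg_cst|exact: csq]|exact: csq].
apply: cvgB; first by apply: cvgM => //; exact: cvg_cst.
apply: cvgM; first by apply: cvgM => //; exact: cvg_cst.
apply: cvgM; first exact: cvgV.
apply: cexp; apply: cvgM; first by apply: cvgN; exact: csq.
apply: cvgV; first by rewrite mulf_neq0.
by apply: cvgM => //; exact: cvg_cst.
Qed.

(** Restriction of [Z] to a line in space, which reduces partial derivatives to one variable. The
    directions used are [(1,0)], [(0,1)] and [(1,-1)]. *)
Let Zdir t x y (al be h : R) : R := Z t (x + al * h) (y + be * h).

Let dZdir t x y (al be h : R) : R :=
  al * U t (x + al * h) - be * U t (y + be * h) +
  (eps * expR (c * t) * (2 * al * (x + al * h) + 2 * be * (y + be * h)) -
   (al - be) * barrier_dz b A t (x + al * h - (y + be * h))).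

Let ddZdir t x y (al be : R) : R :=
  al ^+ 2 * V t x - be ^+ 2 * V t y +
  (eps * expR (c * t) * (2 * al ^+ 2 + 2 * be ^+ 2) -
   (al - be) ^+ 2 * barrier_dzz A t (x - y)).

Let is_derive_line (x al h : R) : is_derive h (1:R) (fun h => x + al * h) al.
Proof.
have /is_derive_eq := is_derive_add (is_derive_cst x h 1) (is_derive_affine al h).
by apply; rewrite add0r.
Qed.

Let is_derive_comp_line (f : R -> R) (x al h l : R) :
  is_derive (x + al * h) (1:R) f l ->
  is_derive h (1:R) (fun h => f (x + al * h)) (l * al).
Proof.
by move=> fl; apply: (@is_derive1_comp R f (fun h => x + al * h)).
Qed.

Let is_derive_comp_diff (f : R -> R) (x y al be h l : R) :
  is_derive (x + al * h - (y + be * h)) (1:R) f l ->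
  is_derive h (1:R) (fun h => f (x + al * h - (y + be * h))) (l * (al - be)).
Proof.
have E h' : x + al * h' - (y + be * h') = (x - y) + (al - be) * h' by ring.
rewrite E => /is_derive_comp_line.
by under [X in _ -> is_derive _ _ X _]eq_fun do rewrite E.
Qed.

Let is_derive_Zdir t x y al be h : 0 <= t <= T ->
  is_derive h (1:R) (Zdir t x y al be) (dZdir t x y al be h).
Proof.
move=> tT; have /andP[t0 _] := tT.
have d1 := is_derive_comp_line (dPhi (x + al * h) tT).
have d2 := is_derive_comp_line (dPhi (y + be * h) tT).
have d3 := is_derive_comp_diff (is_derive_barrier b A (x + al * h - (y + be * h)) t0).
have d4 := is_derive_line x al h.
have d5 := is_derive_line y be h.
by rewrite /Zdir /Z; is_deriv; rewrite /dZdir; ring.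
Qed.

Let is_derive_dZdir t x y al be : 0 <= t <= T ->
  is_derive 0 (1:R) (dZdir t x y al be) (ddZdir t x y al be).
Proof.
move=> tT; have /andP[t0 _] := tT.
have d1 := is_derive_comp_line (h := 0) (dU (x + al * 0) tT).
have d2 := is_derive_comp_line (h := 0) (dU (y + be * 0) tT).
have d3 := is_derive_comp_diff (is_derive_barrier_dz b A (x + al * 0 - (y + be * 0)) t0).
have d4 := is_derive_line x al 0.
have d5 := is_derive_line y be 0.
by rewrite /dZdir; is_deriv; rewrite /ddZdir !mulr0 !addr0; ring.
Qed.

(* At an interior minimum in space reached from earlier times, the two first-order
   conditions make the transport terms cancel up to the penalization. *)
Let no_interior_min t x y rho : 0 < t <= T -> y < x -> 0 < rho ->
  (forall t' x' y', 0 <= t' <= t -> `|x' - x| < rho -> `|y' - y| < rho ->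
     Z t x y <= Z t' x' y') -> False.
Proof.
move=> tT0 yx rho0 Zmin; have /andP[t0 tT'] := tT0.
have tT : 0 <= t <= T by rewrite (ltW t0).
have tt : 0 <= t <= t by rewrite (ltW t0) lexx.
have dirmin al be h : `|al| <= 1 -> `|be| <= 1 -> `|h| < rho ->
    Zdir t x y al be 0 <= Zdir t x y al be (0 + h).
  move=> al1 be1 hr; rewrite /Zdir !mulr0 !addr0 add0r.
  apply: Zmin => //; rewrite addrAC subrr add0r normrM.
    by apply: le_lt_trans hr; rewrite ler_piMl.
  by apply: le_lt_trans hr; rewrite ler_piMl.
have n1 : `|1 : R| <= 1 by rewrite normr1.
have n0 : `|0 : R| <= 1 by rewrite normr0.
have nN1 : `|-1 : R| <= 1 by rewrite normrN1.
have Ex := local_min_derive0 rho0 (is_derive_Zdir x y 1 0 0 tT) (fun h => dirmin 1 0 h n1 n0).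
have Ey := local_min_derive0 rho0 (is_derive_Zdir x y 0 1 0 tT) (fun h => dirmin 0 1 h n0 n1).
have Exx := local_min_second_derive rho0 (fun h _ => is_derive_Zdir x y 1 (-1) (0 + h) tT)
  (is_derive_dZdir x y 1 (-1) tT) (fun h => dirmin 1 (-1) h n1 nN1).
rewrite /dZdir !(mul0r, mulr0, addr0, subr0, mul1r, mulr1, sub0r, add0r) in Ex Ey.
rewrite /ddZdir expr1n sqrrN expr1n !mul1r mulr1 in Exx.
set E := eps * expR (c * t) in Ex Ey Exx.
have E0 : 0 < E by rewrite mulr_gt0// expR_gt0.
have z0 : 0 <= x - y by rewrite subr_ge0 ltW.
have sub := barrier_subsolution A0 (ltW t0) z0.
(* Adding the two first-order conditions eliminates the slope of the barrier. *)
have UU : U t x - U t y = - (2 * E * (x + y)) by lra.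
have E20 : 0 < 2 * E by lra.
have := H_ge x y tT; rewrite UU normrN normrM (gtr0_norm E20) => Hxy.
set Q := 1 + x ^+ 2 + y ^+ 2.
have xyQ : `|x + y| <= Q.
  rewrite ler_norml /Q; apply/andP; split; have := sqr_ge0 (x + 1); have := sqr_ge0 (y + 1);
  have := sqr_ge0 (x - 1); have := sqr_ge0 (y - 1); have := sqr_ge0 x; have := sqr_ge0 y; nra.
have Q1 : 1 <= Q by rewrite /Q -addrA lerDl addr_ge0// sqr_ge0.
pose S t := eps * expR (c * t) * Q + 2 * r * t - barrier b A t (x - y).
have dS : is_derive t (1:R) S (E * c * Q + 2 * r - barrier_dt A t (x - y)).
  have d1 := is_derive_barrier_time b A (x - y) (ltW t0).
  by rewrite /S; is_deriv; rewrite /E; ring.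
(* The left side is the time derivative of [Z], nonpositive at a minimum over earlier times. The
   space conditions bound it below by [E Q > 0]. *)
suff : (V t x + H t x) - (V t y + H t y) +
    (E * c * Q + 2 * r - barrier_dt A t (x - y)) <= 0.
  have cQ : L * (E * `|x + y|) <= L * (E * Q) by rewrite ler_wpM2l// ler_pM2l.
  have EQ : E <= E * Q by rewrite ler_peMr// ltW.
  rewrite /c (_ : E * (5 + 2 * L) * Q = 5 * (E * Q) + 2 * (L * (E * Q))); last by ring.
  rewrite (_ : L * (2 * E * `|x + y|) = 2 * (L * (E * `|x + y|))) in Hxy; last by ring.
  by move: Exx; rewrite (_ : (1 - -1) ^+ 2 = 4); [lra|ring].
apply/ler_addgt0Pr => e e0; rewrite add0r.
have e2 : 0 < e / 2 by rewrite divr_gt0.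
have [d1 d10 H1] := Phi_t x y tT0 e2.
have [d2 d20 H2] := is_derive_linear_approx dS e2.
pose h := Num.min t (Num.min d1 d2) / 2.
have m0 : 0 < Num.min t (Num.min d1 d2) by rewrite !lt_min t0 d10.
have h0 : 0 < h by rewrite divr_gt0.
have : h < Num.min t (Num.min d1 d2) by rewrite ltr_pdivrMr// ltr_pMr// ltr1n.
rewrite !lt_min => /and3P[ht hd1 hd2].
have := H1 h; rewrite h0 hd1 (ltW ht) => /(_ isT isT).
have := H2 (- h); rewrite normrN (gtr0_norm h0) => /(_ hd2).
have := Zmin (t - h) x y; rewrite !subrr normr0 subr_ge0 (ltW ht) gerBl (ltW h0).
move=> /(_ isT rho0 rho0); rewrite /Z -/Q -/(S t) -/(S (t - h)).
rewrite !ler_norml => Z1 /andP[S1 S2] /andP[P1 P2].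
set D' := E * c * Q + _ - _ in S1 S2 *.
have : h * (V t x + H t x - (V t y + H t y) + D') <= h * e by lra.
by rewrite ler_pM2l.
Qed.

(** A negative value would give a negative minimum on a compact box. It cannot lie at time 0, on the
    diagonal or far away, and [no_interior_min] excludes the rest, final time included. *)
Lemma penalized_ge0 t x y : 0 <= t <= T -> y <= x -> 0 <= Z t x y.
Proof.
move=> tT yx; rewrite leNgt; apply/negP => Zneg.
pose k := M + `|b|.
have k0 : 0 <= k by rewrite addr_ge0.
(* Beyond [2 k / eps] the quadratic penalty beats the linear growth, at rate [k], of the other
   terms; [|x| + |y|] puts the given point inside the box. *)
pose N := 2 * k / eps + `|x| + `|y| + 1.
have kN : 0 <= 2 * k / eps by rewrite divr_ge0 ?mulr_ge0// ltW.
have N0 : 0 < N by rewrite ltr_wpDl// !addr_ge0.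
have Z_far t' x' y' : 0 <= t' <= T -> y' <= x' -> N <= `|x'| \/ N <= `|y'| -> 0 < Z t' x' y'.
  move=> t'T yx' far; have /andP[t'0 _] := t'T.
  have z0 : 0 <= x' - y' by rewrite subr_ge0.
  have h1 : - (M * (x' - y')) <= Phi t' x' - Phi t' y'.
    by have := Phi_lipx x' y' t'T; rewrite ler_norml (ger0_norm z0) => /andP[].
  have h2 : barrier b A t' (x' - y') <= `|b| * (x' - y').
    by apply: (le_trans (barrier_le b A0 t'0 z0)); rewrite ler_wpM2r// ler_norm.
  have h3 : x' - y' <= `|x'| + `|y'| by apply: le_trans (ler_norm _) (ler_normB _ _).
  have h4 : k * (x' - y') <= k * (`|x'| + `|y'|) by rewrite ler_wpM2l.
  have h5 : eps * (1 + x' ^+ 2 + y' ^+ 2) <= eps * expR (c * t') * (1 + x' ^+ 2 + y' ^+ 2).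
    rewrite ler_wpM2r ?addr_ge0 ?sqr_ge0// ler_peMr ?(ltW eps0)//.
    by rewrite -[leLHS]expR0 ler_expR mulr_ge0// /c addr_ge0// mulr_ge0.
  have h6 : 0 <= 2 * r * t' by rewrite !mulr_ge0.
  have kE : k = eps * (k / eps) by field; rewrite lt0r_neq0.
  set w := k / eps in kE; have w0 : 0 <= w by rewrite divr_ge0// ltW.
  have Nw : 2 * w < N.
    rewrite /N (_ : 2 * k / eps = 2 * w); last by rewrite /w mulrA.
    by have := normr_ge0 x; have := normr_ge0 y; lra.
  have sx := real_normK (num_real x'); have sy := real_normK (num_real y').
  set ax := `|x'| in far h3 h4 sx; set ay := `|y'| in far h3 h4 sy.
  have ax0 : 0 <= ax by exact: normr_ge0.
  have ay0 : 0 <= ay by exact: normr_ge0.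
  suff key : 0 < 1 + x' ^+ 2 + y' ^+ 2 - w * (ax + ay).
    have : 0 < eps * (1 + x' ^+ 2 + y' ^+ 2 - w * (ax + ay)) by rewrite mulr_gt0.
    rewrite mulrBr mulrA -kE /Z /k; move: h4; rewrite /k; lra.
  rewrite -sx -sy; case: far => far.
    have := sqr_ge0 (ay - w / 2); have : w * w <= ax * (ax - w) by nra.
    by nra.
  have := sqr_ge0 (ax - w / 2); have : w * w <= ay * (ay - w) by nra.
  by nra.
have Z_diag t' x' : 0 <= t' <= T -> 0 < Z t' x' x'.
  move=> /andP[t'0 _]; rewrite /Z subrr add0r subrr /barrier !(mulr0, mul0r) !subr0.
  rewrite ltr_pwDl ?mulr_ge0// !mulr_gt0 ?expR_gt0//.
  by rewrite -addrA ltr_pwDl// addr_ge0// sqr_ge0.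
have Z_init x' y' : y' <= x' -> 0 < Z 0 x' y'.
  move=> yx'; have := Phi0 yx'; rewrite /Z mulr0 expR0 mulr1 mulr0 addr0 => P0.
  have : 0 < eps * (1 + x' ^+ 2 + y' ^+ 2).
    by rewrite mulr_gt0// -addrA ltr_pwDl// addr_ge0// sqr_ge0.
  by lra.
(* In the coordinates [(t, y, x - y)] the constraint [y <= x] becomes a product condition, so
   compactness is immediate. *)
pose box : set (R * R * R) := (`[0, T] `*` `[- N, N]) `*` `[0, 2 * N].
pose W (p : R * R * R) : R := Z p.1.1 (p.1.2 + p.2) p.1.2.
have boxP t' y' z' : box (t', y', z') <-> [/\ 0 <= t' <= T, - N <= y' <= N & 0 <= z' <= 2 * N].
  rewrite /box /=; split; first by move=> [[/=]]; rewrite !in_itv/=.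
  by move=> [*]; split; [split|]; rewrite /= in_itv/=.
have cbox : compact box.
  by apply: compact_setX; [apply: compact_setX|]; exact: segment_compact.
have xN : `|x| <= N by rewrite /N; have := normr_ge0 y; lra.
have yN : `|y| <= N by rewrite /N; have := normr_ge0 x; lra.
move: xN yN; rewrite !ler_norml => /andP[xN1 xN2] /andP[yN1 yN2].
have box1 : box (t, y, x - y).
  by apply/boxP; split => //; [rewrite yN1|rewrite subr_ge0 yx; lra].
have cW : {within box, continuous W}.
  apply/subspace_continuousP => -[[t' y'] z'] /boxP[t'T y'N z'N].
  have c11 : p.1.1 @[p --> within box (nbhs (t', y', z'))] --> t'.
    apply: cvg_within_filter; apply: (@cvg_comp _ _ _ fst fst _ (nbhs (t', y'))); exact: cvg_fst.
  have c12 : p.1.2 @[p --> within box (nbhs (t', y', z'))] --> y'.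
    apply: cvg_within_filter; apply: (@cvg_comp _ _ _ fst snd _ (nbhs (t', y'))); [exact: cvg_fst|exact: cvg_snd].
  have c2 : p.2 @[p --> within box (nbhs (t', y', z'))] --> z'.
    by apply: cvg_within_filter; exact: cvg_snd.
  apply: Z_cvg => //.
    by apply: filterS (withinT _ _) => -[[a1 a2] a3] /boxP[].
  exact: cvgD.
have [[[t2 y2] z2]] := compact_EVT_min (ex_intro _ _ box1) cbox cW.
rewrite inE => /boxP[t2T y2N z2N] Wmin.
have Zmin t' x' y' : 0 <= t' <= T -> - N <= y' <= N -> 0 <= x' - y' <= 2 * N ->
    Z t2 (y2 + z2) y2 <= Z t' x' y'.
  move=> t'T y'N z'N.
  have := Wmin (t', y', x' - y'); rewrite inE /W/= subrKC; apply.
  by apply/boxP.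
have Z2neg : Z t2 (y2 + z2) y2 < 0.
  apply: le_lt_trans Zneg; apply: Zmin => //; first by rewrite yN1.
  by rewrite subr_ge0 yx; lra.
move: (y2N) (z2N) (t2T) => /andP[y21 y22] /andP[z21 z22] /andP[t21 t22].
have yx2 : y2 <= y2 + z2 by rewrite lerDl.
have near : ~ (N <= `|y2 + z2| \/ N <= `|y2|).
  by move=> /(Z_far _ _ _ t2T yx2); rewrite ltNge (ltW Z2neg).
have not_far : `|y2 + z2| < N /\ `|y2| < N.
  by split; rewrite ltNge; apply/negP => far; apply: near; [left|right].
move: not_far; rewrite !ltr_norml => -[/andP[f1 f2] /andP[f3 f4]].
have z2pos : 0 < z2.
  rewrite lt_neqAle z21 andbT; apply/negP => /eqP z20.
  by have := Z_diag t2 y2 t2T; rewrite ltNge; move: (ltW Z2neg); rewrite -z20 addr0 => ->.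
have t2pos : 0 < t2.
  rewrite lt_neqAle t21 andbT; apply/negP => /eqP t20.
  by have := Z_init _ _ yx2; rewrite ltNge; move: (ltW Z2neg); rewrite -t20 => ->.
pose rho := Num.min (Num.min (z2 / 2) (N - (y2 + z2))) (Num.min (N - y2) (N + y2)).
have rho0 : 0 < rho by rewrite !lt_min; apply/andP; split; apply/andP; split; lra.
apply: (@no_interior_min t2 (y2 + z2) y2 rho) => //.
- by rewrite t2pos.
- by rewrite ltrDl.
move=> t' x' y' /andP[t'0 t't2]; rewrite !lt_min !ltr_norml.
move=> /andP[/andP[/andP[? ?] /andP[? ?]] /andP[/andP[? ?] /andP[? ?]]].
move=> /andP[/andP[/andP[? ?] /andP[? ?]] /andP[/andP[? ?] /andP[? ?]]].
apply: Zmin.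
- by rewrite t'0 (le_trans t't2).
- by apply/andP; split; lra.
- by apply/andP; split; lra.
Qed.

End Penalized.

Theorem modulus_bound t x y : 0 <= t <= T -> y <= x ->
  barrier b A t (x - y) - 2 * r * t <= Phi t x - Phi t y.
Proof.
move=> tT yx.
(* The coefficient of [eps] in the penalized inequality; taking [eps = e / q] lets the penalty
   vanish with [e]. *)
pose q := expR ((5 + 2 * L) * t) * (1 + x ^+ 2 + y ^+ 2).
have q0 : 0 < q by rewrite mulr_gt0 ?expR_gt0// -addrA ltr_pwDl// addr_ge0// sqr_ge0.
apply/ler_addgt0Pr => e e0.
have eq0 : 0 < e / q by rewrite divr_gt0.
have := penalized_ge0 eq0 tT yx.
by rewrite -(mulrA (e / q)) -/q divfK ?lt0r_neq0//; lra.
Qed.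

End MaximumPrinciple.

(** * Primitives normalized to vanish at 0 *)

Section Antiderivative.
Variable R : realType.
Notation mu := (@lebesgue_measure R).
Implicit Types (f : R -> R) (a x y : R).

(** The lower endpoint lies below both [x] and 0, so no oriented integral is needed; the difference
    does not depend on it. *)
Definition antiderivative f x : R :=
  Rintegral mu `[- (`|x| + 1), x] f - Rintegral mu `[- (`|x| + 1), 0] f.

Let continuous_integrable f a b : continuous f -> mu.-integrable `[a, b] (EFin \o f).
Proof.
move=> cf; apply: continuous_compact_integrable; first exact: segment_compact.
exact: continuous_subspaceT.
Qed.

Lemma antiderivativeE f a x : continuous f -> a <= x -> a <= 0 ->
  antiderivative f x = Rintegral mu `[a, x] f - Rintegral mu `[a, 0] f.
Proof.
move=> cf.
have indep (a1 a2 : R) : a1 <= a2 -> a2 <= x -> a2 <= 0 ->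
    Rintegral mu `[a1, x] f - Rintegral mu `[a1, 0] f =
    Rintegral mu `[a2, x] f - Rintegral mu `[a2, 0] f.
  move=> a12 a2x a20.
  rewrite (Rintegral_itv_split a12 a2x); last exact: continuous_integrable.
  rewrite (Rintegral_itv_split a12 a20); last exact: continuous_integrable.
  by ring.
move=> ax a0; rewrite /antiderivative.
have nx : - (`|x| + 1) <= x by have := ler_norm (- x); rewrite normrN; lra.
have n0 : - (`|x| + 1) <= 0 by have := normr_ge0 x; lra.
by have [h|/ltW h] := leP a (- (`|x| + 1)); [rewrite (indep _ _ h)|rewrite -(indep _ _ h)].
Qed.

Lemma antiderivative0 f : continuous f -> antiderivative f 0 = 0.
Proof. by move=> cf; rewrite (antiderivativeE cf (lexx 0) (lexx 0)) subrr. Qed.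

Lemma is_derive_antiderivative f x : continuous f ->
  is_derive x (1:R) (antiderivative f) (f x).
Proof.
move=> cf; pose a := - (`|x| + 2).
have ax : a < x by have := ler_norm (- x); rewrite normrN /a; lra.
have a0 : a <= 0 by have := normr_ge0 x; rewrite /a; lra.
have x1 : x < x + 1 by rewrite ltrDl.
have [dF F'] := continuous_FTC1_closed x1 (continuous_integrable a (x + 1) cf) ax (cf x).
set F := (F in derivable F _ _) in dF F'.
have dF' : is_derive x (1:R) F (f x) by split; rewrite -?F' ?derive1E.
have dG : is_derive x (1:R) (fun y => F y - Rintegral mu `[a, 0] f) (f x).
  have /is_derive_eq := is_derive_add dF' (is_derive_cst (- Rintegral mu `[a, 0] f) x 1).
  by apply; rewrite addr0.
apply: near_eq_is_derive dG => //.
exists (x - a) => /=; first by rewrite subr_gt0.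
move=> y /=; rewrite ltr_norml => /andP[_ xy].
by rewrite (antiderivativeE cf _ a0)//; lra.
Qed.

End Antiderivative.

(** * Uniformity by compactness of a time segment *)

Section UniformOnSegments.
Variable R : realType.

(** Compactness in near-covering form, along the filter of small positive [d]. Monotonicity in [d]
    lets a local threshold serve all smaller values. *)
Lemma uniform_on_segment (Q : R -> R -> Prop) (T : R) :
  (forall t d d', 0 < d' -> d' <= d -> Q t d -> Q t d') ->
  (forall t, 0 <= t <= T -> exists2 d, 0 < d &
     forall s, 0 <= s <= T -> `|s - t| < d -> Q s d) ->
  exists2 d, 0 < d & forall t, 0 <= t <= T -> Q t d.
Proof.
move=> Qmono Qloc.
have /compact_near_coveringP cov := @segment_compact R 0 T.
have := @cov R (0 : R)^'+ (fun d t => 0 <= t <= T -> Q t d) _.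
case.
  move=> t; rewrite /= in_itv/= => /Qloc[d d0 Hd].
  have Fd : \forall e \near (0 : R)^'+, 0 < e <= d.
    near=> e; apply/andP; split; near: e; first exact: nbhs_right_gt.
    by near do apply: ltW; exact: nbhs_right_lt.
  exists (ball t d, [set e | 0 < e <= d]); first split => /=.
  - exact: nbhsx_ballx.
  - exact: Fd.
  - move=> [s e] [/= ts /andP[e0 ed]] sT.
    by apply: (Qmono _ _ _ e0 ed); apply: Hd => //; rewrite distrC.
move=> /= d d0 Hd; exists (d / 2); first by rewrite divr_gt0.
move=> t tT; apply: (Hd (d / 2)) => //=.
- by rewrite sub0r normrN gtr0_norm ?divr_gt0// ltr_pdivrMr// ltr_pMr// ltr1n.
- by rewrite divr_gt0.
Unshelve. all: by end_near. Qed.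

End UniformOnSegments.

(** * Uniform bounds and continuity along the solution curve *)

Section MildSolutions.
Variable R : realType.
Notation mu := (@lebesgue_measure R).
Implicit Types (f : R -> R) (u G : R -> R -> R) (t s x y e d T : R).

Lemma unif_cont_continuous (g : R -> R) : unif_cont g -> continuous g.
Proof.
move=> gu x; apply/cvgrPdist_lt => e e0; have [d [d0 gd]] := gu e e0.
by apply/nbhs_ballP; exists d => //= y; exact: gd.
Qed.

Lemma curve_C_ub_bounded u T : curve_C_ub u ->
  exists2 M, 0 < M & forall t, 0 <= t <= T -> forall x, `|u t x| <= M.
Proof.
move=> [uC ut].
(* A bound is written as [d^-1], so that small thresholds correspond to large bounds and the
   compactness lemma applies. *)
suff [d d0 Hd] : exists2 d, 0 < d & forall t, 0 <= t <= T -> forall x, `|u t x| <= d^-1.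
  by exists d^-1; [rewrite invr_gt0|].
apply: uniform_on_segment.
- move=> t d d' d'0 d'd H x; apply: (le_trans (H x)).
  by rewrite lef_pV2 ?posrE// (lt_le_trans d'0).
- move=> t tT; have /andP[t0 _] := tT; have [[M uM] _] := uC t t0.
  have [d [d0 Hd]] := ut t t0 1 ltr01.
  have M0 : 0 <= M by apply: le_trans (uM 0).
  have M2 : 0 < M + 1 by rewrite ltr_wpDl.
  exists (Num.min d (M + 1)^-1); first by rewrite lt_min d0 invr_gt0.
  move=> s /andP[s0 _]; rewrite lt_min => /andP[sd _] x.
  apply: (@le_trans _ _ (M + 1)); last first.
    rewrite -[leLHS]invrK lef_pV2 ?posrE ?invr_gt0// ?ge_min ?lexx ?orbT//.
    by rewrite lt_min d0 invr_gt0.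
  have := Hd s s0 sd x; have := uM x.
  rewrite (_ : u s x = (u s x - u t x) + u t x); last by ring.
  have := ler_normD (u s x - u t x) (u t x).
  by rewrite subrK; lra.
Qed.

Lemma curve_C_ub_unif_time u T e : curve_C_ub u -> 0 < e ->
  exists2 d, 0 < d & forall t, 0 <= t <= T -> forall s, 0 <= s -> `|s - t| < d ->
    forall x, `|u s x - u t x| <= e.
Proof.
move=> [_ ut] e0; apply: uniform_on_segment.
  by move=> t d d' d'0 d'd H s s0 sd; apply: H => //; exact: lt_le_trans d'd.
move=> t /andP[t0 _].
have e2 : 0 < e / 2 by rewrite divr_gt0.
have [d [d0 Hd]] := ut t t0 _ e2.
exists (d / 2); first by rewrite divr_gt0.
move=> s /andP[s0 _] sd s' s'0 s'd x.
have s't : `|s' - t| < d.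
  rewrite (_ : s' - t = (s' - s) + (s - t)); last by ring.
  by apply: (le_lt_trans (ler_normD _ _)); lra.
have st : `|s - t| < d by lra.
have h1 := Hd _ s'0 s't x; have h2 := Hd _ s0 st x.
rewrite (_ : _ - _ = (u s' x - u t x) - (u s x - u t x)); last by ring.
by apply: (le_trans (ler_normB _ _)); lra.
Qed.

Lemma curve_C_ub_unif_space u T e : curve_C_ub u -> 0 < e ->
  exists2 d, 0 < d & forall t, 0 <= t <= T -> forall x y, `|x - y| < d ->
    `|u t x - u t y| <= e.
Proof.
move=> [uC ut] e0; apply: uniform_on_segment.
  by move=> t d d' d'0 d'd H x y xy; apply: H => //; exact: lt_le_trans d'd.
move=> t /andP[t0 _].
have e3 : 0 < e / 3 by rewrite divr_gt0.
have [d [d0 Hd]] := ut t t0 _ e3.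
have [_ uu] := uC t t0; have [d' [d'0 Hd']] := uu _ e3.
exists (Num.min d d'); first by rewrite lt_min d0.
move=> s /andP[s0 _]; rewrite lt_min => /andP[sd _] x y; rewrite lt_min => /andP[_ xy].
have h1 := Hd _ s0 sd x; have h2 := Hd _ s0 sd y; have h3 := Hd' _ _ xy.
rewrite (_ : _ - _ = (u s x - u t x) + (u t x - u t y) - (u s y - u t y)); last by ring.
apply: (le_trans (ler_normB _ _)); apply: (le_trans (lerD (ler_normD _ _) (lexx _))).
by lra.
Qed.

Lemma dx_heat_sg_cont_on G M T b x : 0 < b <= T ->
  (forall s, 0 <= s <= T -> continuous (G s)) ->
  (forall s, 0 <= s <= T -> forall y, `|G s y| <= M) ->
  (forall s0, 0 <= s0 <= T -> forall e, 0 < e -> exists2 r, 0 < r &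
    forall s, 0 <= s <= T -> `|s - s0| < r -> forall y, `|G s y - G s0 y| <= e) ->
  cont_on `[0, b[ (fun s => dx_heat_sg (b - s) (G s) x).
Proof.
move=> /andP[b0 bT] Gc GM Gt s0 /=; rewrite in_itv/= => /andP[s00 s0b] e e0.
(* For [s] close to [s0] the age [b - s] stays above half of [b - s0], where the regular estimates
   hold. *)
have d0 : 0 < (b - s0) / 2 by rewrite divr_gt0// subr_gt0.
have [C C0 [est stab]] := ex_heat_sg_estimates T d0.
have s0T : 0 <= s0 <= T by rewrite s00; lra.
have M0 : 0 <= M by apply: le_trans (GM _ s0T 0).
have C1 : 0 < 2 * (C + 1) by rewrite mulr_gt0// ltr_wpDl.
have CM0 : 0 <= C * M by rewrite mulr_ge0.
have CM1 : 0 < 2 * (C * M + 1) by rewrite mulr_gt0// ltr_wpDl.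
have [r r0 Gr] := Gt _ s0T _ (divr_gt0 e0 C1).
exists (Num.min (Num.min r ((b - s0) / 2)) (e / (2 * (C * M + 1)))).
  by rewrite !lt_min r0 d0 divr_gt0.
move=> s; rewrite in_itv/= => /andP[s_ge0 sb]; rewrite !lt_min => /andP[/andP[sr sd] ss0].
have sT : 0 <= s <= T by rewrite s_ge0; lra.
have in0 : (b - s0) / 2 <= b - s0 <= T by apply/andP; split; lra.
have ins : (b - s0) / 2 <= b - s <= T.
  by move: sd; rewrite ltr_norml => /andP[? ?]; apply/andP; split; lra.
have [_ _ _ _ /(_ _ ins)[_ h1 _]] := est _ _ _ x (Gc _ sT) (GM _ sT) in0.
have [_ h2 _] := stab _ _ _ _ _ _ x (Gc _ sT) (Gc _ s0T) (GM _ sT) (GM _ s0T) (Gr _ sT sr) in0.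
rewrite (_ : b - s - (b - s0) = - (s - s0)) in h1; last by ring.
rewrite normrN in h1.
rewrite (_ : _ - _ = (dx_heat_sg (b - s) (G s) x - dx_heat_sg (b - s0) (G s) x) +
   (dx_heat_sg (b - s0) (G s) x - dx_heat_sg (b - s0) (G s0) x)); last by ring.
apply: (le_trans (ler_normD _ _)).
rewrite [leRHS](_ : e = e / 2 + e / 2); last by field.
apply: lerD.
  apply: (le_trans h1); rewrite [leRHS](_ : _ = (C * M + 1) * (e / (2 * (C * M + 1)))).
    by apply: ler_pM => //; [rewrite lerDl|exact: ltW].
  by field; rewrite lt0r_neq0// ltr_wpDl.
apply: (le_trans h2); rewrite [leRHS](_ : _ = (C + 1) * (e / (2 * (C + 1)))).
  by rewrite ler_wpM2r ?lerDl// divr_ge0// ltW.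
by field; rewrite lt0r_neq0// ltr_wpDl.
Qed.

End MildSolutions.

(** * The smoothed potential, and transfer of the comparison to the mild solution *)

Section Approximation.
Variable R : realType.
Notation mu := (@lebesgue_measure R).
Implicit Types (t s x y e : R).

Section HeatPotential.
Variables (g : R -> R) (M d T C : R).
Hypothesis C0 : 0 <= C.
Hypothesis gc : continuous g.
Hypothesis gM : forall y, `|g y| <= M.
Hypothesis est : heat_sg_estimates d T C.

Lemma is_derive_heat_sg t x : d <= t <= T ->
  is_derive x (1:R) (heat_sg t g) (dx_heat_sg t g x).
Proof.
move=> dt; have [_ H _ _ _] := est x gc gM dt.
exact: is_derive_of_remainder H.
Qed.

Lemma is_derive_dx_heat_sg t x : d <= t <= T ->
  is_derive x (1:R) (dx_heat_sg t g) (dxx_heat_sg t g x).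
Proof.
move=> dt; have [_ _ H _ _] := est x gc gM dt.
exact: is_derive_of_remainder H.
Qed.

(* Locked, so that conversion never compares the underlying integrals. *)
Fact heat_potential_key : unit. Proof. exact: tt. Qed.
Definition heat_potential : R -> R -> R :=
  locked_with heat_potential_key (fun t => antiderivative (heat_sg t g)).

Lemma heat_potentialE t : heat_potential t = antiderivative (heat_sg t g).
Proof. by rewrite /heat_potential unlock. Qed.

Lemma continuous_heat_sg t : d <= t <= T -> continuous (heat_sg t g).
Proof. by move=> dt x; exact: is_derive_cont (is_derive_heat_sg x dt). Qed.

Lemma is_derive_heat_potential t x : d <= t <= T ->
  is_derive x (1:R) (heat_potential t) (heat_sg t g x).
Proof.
by rewrite heat_potentialE => /continuous_heat_sg; exact: is_derive_antiderivative.
Qed.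

Lemma heat_potential0 t : d <= t <= T -> heat_potential t 0 = 0.
Proof. by rewrite heat_potentialE => /continuous_heat_sg; exact: antiderivative0. Qed.

Lemma heat_potential_lipschitz s t x : d <= s <= T -> d <= t <= T ->
  `|heat_potential s x - heat_potential t x| <= C * M * `|s - t| * `|x|.
Proof.
move=> ds dt.
have := @lipschitz_of_derive R (fun x => heat_potential s x - heat_potential t x)
  (fun x => heat_sg s g x - heat_sg t g x) (C * M * `|s - t|) 0 x.
cbv beta; rewrite (heat_potential0 ds) (heat_potential0 dt) (subrr 0) (subr0 x).
rewrite (subr0 (heat_potential s x - heat_potential t x)); apply => w _.
  by apply: is_derive_add; [|apply: is_derive_opp]; exact: is_derive_heat_potential.
by have [_ _ _ _ /(_ _ ds)[]] := est w gc gM dt.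
Qed.

(** Obtained by integrating in space, from 0 to [x], the time expansion of the semigroup. The
    boundary term at 0 comes from the normalization and cancels in increments of the potential. *)
Lemma heat_potential_time_derivative s t x : d <= s <= T -> d <= t <= T ->
  `|heat_potential s x - heat_potential t x -
    (s - t) * (dx_heat_sg t g x - dx_heat_sg t g 0)| <= C * M * (s - t) ^+ 2 * `|x|.
Proof.
move=> ds dt.
have := @lipschitz_of_derive R
  (fun x => heat_potential s x - heat_potential t x - (s - t) * dx_heat_sg t g x)
  (fun x => heat_sg s g x - heat_sg t g x - (s - t) * dxx_heat_sg t g x)
  (C * M * (s - t) ^+ 2) 0 x.
cbv beta; rewrite (heat_potential0 ds) (heat_potential0 dt) (subrr 0) (subr0 x).
have E (p k v v0 : R) : p - k * v - (0 - k * v0) = p - k * (v - v0) by ring.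
rewrite E; apply => w _.
  have dp := is_derive_add (is_derive_heat_potential w ds)
    (is_derive_opp (is_derive_heat_potential w dt)).
  have dv := is_derive_mul (is_derive_cst (s - t) w 1) (is_derive_dx_heat_sg w dt).
  have := is_derive_add dp (is_derive_opp dv).
  by rewrite mul0r add0r.
by have [_ _ _ H _] := est w gc gM dt; exact: H.
Qed.

End HeatPotential.

Lemma ge0_norm_lipschitz (f : R -> R) N : locally_lipschitz f -> 0 < N ->
  exists2 L, 0 <= L & forall x y, `|x| <= N -> `|y| <= N ->
    `|f x - f y| <= L * `|x - y|.
Proof.
move=> fL N0; have [L HL] := fL N N0; exists `|L| => // x y xN yN.
by apply: (le_trans (HL _ _ xN yN)); rewrite ler_wpM2r// ler_norm.
Qed.

(** The shifted formula at [t] is the exact Duhamel formula at [t + d] without its last piece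
    [[t, t + d]], where the kernel bound [2 / sqrt (t + d - s)] integrates to [4 sqrt d]. *)
Lemma mild_solution_tail (f u0 : R -> R) (u : R -> R -> R) T MG d t x :
  mild_solution f u0 u ->
  (forall s, 0 <= s <= T -> continuous (fun y => f (u s y))) ->
  (forall s, 0 <= s <= T -> forall y, `|f (u s y)| <= MG) ->
  (forall s0, 0 <= s0 <= T -> forall e, 0 < e -> exists2 r, 0 < r &
    forall s, 0 <= s <= T -> `|s - s0| < r ->
      forall y, `|f (u s y) - f (u s0 y)| <= e) ->
  0 < d -> 0 <= t -> t + d <= T ->
  `|u (t + d) x - (heat_sg (t + d) u0 x +
     duhamel (fun s y => f (u s y)) d (@dx_heat_sg R) t x)| <= 4 * MG * Num.sqrt d.
Proof.
move=> [_ uE] Gc GM Gt d0 t0 tdT.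
have td0 : 0 < t + d by rewrite ltr_wpDl.
have tdT' : 0 < t + d <= T by rewrite td0.
have MG0 : 0 <= MG by apply: le_trans (GM 0 _ 0) => //; rewrite lexx; lra.
pose F s := dx_heat_sg (t + d - s) (fun y => f (u s y)) x.
have cF := @dx_heat_sg_cont_on R (fun s y => f (u s y)) MG T (t + d) x tdT' Gc GM Gt.
have FK s : 0 <= s < t + d -> `|F s| <= 2 * MG * (Num.sqrt (t + d - s))^-1.
  move=> /andP[s0 std]; rewrite mulrAC; apply: dx_heat_sg_le => //.
  - by rewrite subr_gt0.
  - by apply: Gc; rewrite s0; lra.
  - by apply: GM; rewrite s0; lra.
have MG2 : 0 <= 2 * MG by rewrite mulr_ge0.
have [iF _] := singular_integrable td0 MG2 cF FK.
have ttd : t < t + d by rewrite ltrDl.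
have sub : `[t, (t + d)[ `<=` `[0, (t + d)[.
  by move=> s; rewrite /= !in_itv/= => /andP[ts ->]; rewrite (le_trans t0).
have FK' s : t <= s < t + d -> `|F s| <= 2 * MG * (Num.sqrt (t + d - s))^-1.
  by move=> /andP[ts std]; apply: FK; rewrite std (le_trans t0).
have [_ tail] := singular_integrable ttd MG2 (cont_onS sub cF) FK'.
rewrite (uE _ (ltW td0)) gt_eqF// (Rintegral_itv_split t0 (ltW ttd) iF).
rewrite addrA [X in `|X|]addrC -/(duhamel _ _ _ _ _) addKr.
apply: (le_trans tail); rewrite (_ : t + d - t = d); last by ring.
by rewrite (_ : 2 * MG * (2 * Num.sqrt d) = 4 * MG * Num.sqrt d)//; ring.
Qed.

Lemma ex_small_step (a k e1 e2 r : R) : 0 <= a -> 0 <= k -> 0 < e1 -> 0 < e2 ->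
  0 < r -> exists d, [/\ 0 < d, d <= 1, d < r, a * Num.sqrt d <= e1 & k * d <= e2].
Proof.
move=> a0 k0 e10 e20 r0.
have a1 : 0 < a + 1 by rewrite ltr_wpDl.
have k1 : 0 < k + 1 by rewrite ltr_wpDl.
have q1 : 0 < e1 / (a + 1) by rewrite divr_gt0.
have q2 : 0 < e2 / (k + 1) by rewrite divr_gt0.
have q3 : 0 < r / 2 by rewrite divr_gt0.
pose d := Num.min (Num.min 1 (r / 2)) (Num.min ((e1 / (a + 1)) ^+ 2) (e2 / (k + 1))).
exists d; split.
- by rewrite !lt_min ltr01 q2 q3 exprn_gt0.
- by rewrite !ge_min lexx.
- by apply: (@le_lt_trans _ _ (r / 2)); [rewrite !ge_min lexx !orbT|lra].
- have : Num.sqrt d <= e1 / (a + 1).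
    rewrite -[leRHS]ger0_norm ?(ltW q1)// -sqrtr_sqr.
    by apply: ler_wsqrtr; rewrite !ge_min lexx !orbT.
  by rewrite ler_pdivlMr// => h; have := sqrtr_ge0 d; lra.
- have : d <= e2 / (k + 1) by rewrite !ge_min lexx !orbT.
  rewrite ler_pdivlMr// => h; apply: le_trans h.
  rewrite mulrC ler_wpM2l ?lerDl//.
  by rewrite !le_min ler01 (ltW q2) (ltW q3) exprn_ge0 ?(ltW q1).
Qed.

(** On a bounded time interval [u] takes values in a bounded set, where one Lipschitz constant of
    [f] is valid; boundedness and continuity of [u] then pass to [f(u)]. *)
Lemma forcing_regularity (f : R -> R) (u : R -> R -> R) T :
  locally_lipschitz f -> curve_C_ub u -> 0 <= T ->
  exists M MG L, [/\ 0 < M, 0 <= MG, 0 <= L,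
    forall s, 0 <= s <= T -> forall x, `|u s x| <= M &
    [/\ forall s s' y y', 0 <= s <= T -> 0 <= s' <= T ->
          `|f (u s y) - f (u s' y')| <= L * `|u s y - u s' y'|,
        forall s, 0 <= s <= T -> continuous (fun y => f (u s y)),
        forall s, 0 <= s <= T -> forall y, `|f (u s y)| <= MG &
        forall s0, 0 <= s0 <= T -> forall e, 0 < e -> exists2 r, 0 < r &
          forall s, 0 <= s <= T -> `|s - s0| < r ->
            forall y, `|f (u s y) - f (u s0 y)| <= e]].
Proof.
move=> fL uC T0; have [M M0 uM] := curve_C_ub_bounded T uC.
have [L L0 fM] := ge0_norm_lipschitz fL M0.
have L1 : 0 < L + 1 by rewrite ltr_wpDl.
exists M, (`|f 0| + L * M), L.
have lip s s' y y' : 0 <= s <= T -> 0 <= s' <= T ->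
    `|f (u s y) - f (u s' y')| <= L * `|u s y - u s' y'|.
  by move=> sT s'T; apply: fM; exact: uM.
have lip_e e a : 0 < e -> a <= e / (L + 1) -> L * a <= e.
  move=> e0; rewrite ler_pdivlMr// => h.
  have [a0|/ltW a0] := leP 0 a; first by apply: le_trans h; rewrite mulrC ler_wpM2l ?lerDl.
  by apply: le_trans (ltW e0); rewrite mulr_ge0_le0.
split => //; first by rewrite addr_ge0// mulr_ge0// ltW.
split => //.
- move=> s sT y; have /andP[s0 _] := sT; apply/cvgrPdist_le => e e0.
  have eL : 0 < e / (L + 1) by rewrite divr_gt0.
  have [_ /unif_cont_continuous uc] := uC.1 s s0.
  have := uc y; move/cvgrPdist_le/(_ _ eL); apply: filterS => y' yy'.
  by apply: (le_trans (lip _ _ _ _ sT sT)); exact: lip_e.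
- move=> s sT y; rewrite -[f (u s y)](subrKC (f 0)).
  apply: (le_trans (ler_normD _ _)); rewrite lerD2l.
  have n0 : `|0 : R| <= M by rewrite normr0 ltW.
  by apply: (le_trans (fM _ _ (uM _ sT y) n0)); rewrite subr0 ler_wpM2l// uM.
- move=> s0 s0T e e0; have eL : 0 < e / (L + 1) by rewrite divr_gt0.
  have [r r0 Hr] := curve_C_ub_unif_time T uC eL.
  exists r => // s sT ss0 y; have /andP[s_ge0 _] := sT.
  by apply: (le_trans (lip _ _ _ _ sT s0T)); apply: lip_e => //; exact: Hr.
Qed.

Section SmoothedPotential.
Variables (g : R -> R) (G : R -> R -> R) (N M d T C : R).
Hypothesis T0 : 0 <= T.
Hypothesis C0 : 0 <= C.
Hypothesis gc : continuous g.
Hypothesis gN : forall y, `|g y| <= N.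
Hypothesis Gc : forall s, 0 <= s <= T -> continuous (G s).
Hypothesis GM : forall s, 0 <= s <= T -> forall y, `|G s y| <= M.
Hypothesis Gt : forall s0, 0 <= s0 <= T -> forall e, 0 < e -> exists2 r, 0 < r &
  forall s, 0 <= s <= T -> `|s - s0| < r -> forall y, `|G s y - G s0 y| <= e.
Hypothesis est : heat_sg_estimates d (T + d) C.
Hypothesis stab : heat_sg_stable d (T + d) C.

(** In the Duhamel term, a primitive in space is obtained by dropping the derivative from the
    kernel; only the term of the initial datum needs a genuine antiderivative. *)
Definition potential t x : R :=
  heat_potential g (t + d) x + duhamel G d (@heat_sg R) t x.
Definition potential_dx t x : R :=
  heat_sg (t + d) g x + duhamel G d (@dx_heat_sg R) t x.
Definition potential_dxx t x : R :=
  dx_heat_sg (t + d) g x + duhamel G d (@dxx_heat_sg R) t x.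

Let tdr t : 0 <= t <= T -> d <= t + d <= T + d.
Proof. by move=> /andP[? ?]; apply/andP; split; lra. Qed.

Lemma is_derive_potential t x : 0 <= t <= T ->
  is_derive x (1:R) (potential t) (potential_dx t x).
Proof.
move=> tT; apply: is_derive_add.
  exact: (is_derive_heat_potential gc gN est _ (tdr tT)).
exact: (is_derive_duhamel C0 Gc GM Gt est stab).
Qed.

Lemma is_derive_potential_dx t x : 0 <= t <= T ->
  is_derive x (1:R) (potential_dx t) (potential_dxx t x).
Proof.
move=> tT; apply: is_derive_add.
  exact: (is_derive_heat_sg gc gN est _ (tdr tT)).
exact: (is_derive_dx_duhamel C0 Gc GM Gt est stab).
Qed.

Lemma potential_time_derivative t x y e : 0 < t <= T -> 0 < e ->
  exists2 r, 0 < r & forall h, 0 < h < r -> h <= t ->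
  `|(potential t x - potential t y) - (potential (t - h) x - potential (t - h) y) -
    h * ((potential_dxx t x + heat_sg d (G t) x) -
         (potential_dxx t y + heat_sg d (G t) y))| <= e * h.
Proof.
move=> tT0 e0; have /andP[t0 tT'] := tT0.
have tT : 0 <= t <= T by rewrite (ltW t0).
have e4 : 0 < e / 4 by rewrite divr_gt0.
have [r1 r10 H1] := duhamel_time_derivative C0 Gc GM Gt est stab x tT0 e4.
have [r2 r20 H2] := duhamel_time_derivative C0 Gc GM Gt est stab y tT0 e4.
have N0 : 0 <= N by apply: le_trans (gN 0).
pose k := C * N * (`|x| + `|y|).
have k0 : 0 <= k by rewrite !mulr_ge0// addr_ge0.
have k1 : 0 < k + 1 by rewrite ltr_wpDl.
exists (Num.min (Num.min r1 r2) (e / 2 / (k + 1))).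
  by rewrite !lt_min r10 r20 !divr_gt0.
move=> h /andP[h0]; rewrite !lt_min => /andP[/andP[hr1 hr2] hk] ht.
have := H1 h; rewrite h0 hr1 => /(_ isT ht).
have := H2 h; rewrite h0 hr2 => /(_ isT ht).
have thT : 0 <= t - h <= T.
  by rewrite subr_ge0 ht (le_trans _ tT')// gerBl ltW.
have := heat_potential_time_derivative gc gN est x (tdr thT) (tdr tT).
have := heat_potential_time_derivative gc gN est y (tdr thT) (tdr tT).
rewrite (_ : t - h + d - (t + d) = - h); last by ring.
rewrite sqrrN => Py Px Dy Dx.
move: hk; rewrite ltr_pdivlMr// => hk.
rewrite /potential /potential_dxx.
have E (p p' q q' D D' B B' vx v0 vy w w' m m' : R) :
    (p + D - (q + B)) - (p' + D' - (q' + B')) - h * ((vx + w + m) - (vy + w' + m')) =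
    (D - D' - h * (m + w)) - (B - B' - h * (m' + w')) -
    ((p' - p - (- h) * (vx - v0)) - (q' - q - (- h) * (vy - v0))) by ring.
(* The normalization term at 0 is inserted for [x] and for [y] and cancels between them. *)
rewrite (E _ _ _ _ _ _ _ _ _ (dx_heat_sg (t + d) g 0)).
apply: (le_trans (ler_normB _ _)).
apply: (le_trans (lerD (ler_normB _ _) (ler_normB _ _))).
apply: (le_trans (lerD (lerD Dx Dy) (lerD Px Py))).
have -> : C * N * h ^+ 2 * `|x| + C * N * h ^+ 2 * `|y| = k * h * h.
  by rewrite /k; ring.
have kh : k * h <= e / 2.
  by apply: le_trans (ltW hk); rewrite mulrC ler_wpM2l ?(ltW h0)// lerDl.
rewrite -mulrDl -mulrDl ler_wpM2r ?(ltW h0)//.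
by clear Px Py Dx Dy; lra.
Qed.

Lemma potential_time_lipschitz s t x : 0 <= s <= T -> 0 <= t <= T ->
  `|potential s x - potential t x| <=
    (C * N + (C * M * T + C * M)) * (1 + `|x|) * `|s - t|.
Proof.
move=> sT tT.
have N0 : 0 <= N by apply: le_trans (gN 0).
have M0 : 0 <= M by apply: le_trans (GM tT 0).
have h1 := heat_potential_lipschitz gc gN est x (tdr sT) (tdr tT).
rewrite (_ : s + d - (t + d) = s - t) in h1; last by ring.
have h2 : `|duhamel G d (@heat_sg R) s x - duhamel G d (@heat_sg R) t x| <=
    (C * M * T + C * M) * `|s - t|.
  have [st|/ltW ts] := leP s t.
    have st' : 0 <= s <= t by case/andP: sT => ->.
    have h := duhamel_time_lipschitz C0 Gc GM Gt est stab x st' tT.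
    rewrite distrC (distrC s) (@ger0_norm _ (t - s)); last by rewrite subr_ge0.
    exact: h.
  have ts' : 0 <= t <= s by case/andP: tT => ->.
  have h := duhamel_time_lipschitz C0 Gc GM Gt est stab x ts' sT.
  rewrite (@ger0_norm _ (s - t)); last by rewrite subr_ge0.
  exact: h.
rewrite /potential opprD addrACA.
apply: (le_trans (ler_normD _ _)); apply: (le_trans (lerD h1 h2)).
have w0 := normr_ge0 (s - t); have nx := normr_ge0 x.
have CN0 : 0 <= C * N by rewrite mulr_ge0.
have q0 : 0 <= C * M * T + C * M by rewrite addr_ge0 ?mulr_ge0.
have p1 : 0 <= C * N * `|s - t| by rewrite mulr_ge0.
have p2 : 0 <= (C * M * T + C * M) * `|x| * `|s - t| by rewrite !mulr_ge0.
by clear h1 h2; lra.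
Qed.

Lemma potential_dx_le t x : 0 < d -> 0 <= t <= T ->
  `|potential_dx t x| <= N + C * M * T.
Proof.
move=> d0 tT; apply: (le_trans (ler_normD _ _)); apply: lerD.
  by apply: heat_sg_le => //; case/andP: tT => t0 _; rewrite ltr_wpDl.
exact: (dx_duhamel_le C0 Gc GM Gt est stab).
Qed.

End SmoothedPotential.

(** The initial comparison is assumed for every primitive of a function within [e] of [u0], because
    smoothing has already perturbed the slope of the potential at time 0. The point [xi] is a mean
    value point of that potential. *)
Lemma mild_solution_modulus (f u0 : R -> R) (u : R -> R -> R) (T e b A : R) :
  locally_lipschitz f -> C_ub u0 -> mild_solution f u0 u ->
  0 <= T -> 0 < e -> 0 <= A ->
  (forall p q : R -> R, (forall x, is_derive x (1:R) p (q x)) ->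
    (forall x, `|q x - u0 x| <= e) ->
    forall x y, y <= x -> barrier b A 0 (x - y) <= p x - p y) ->
  forall t x y, 0 <= t <= T -> y <= x ->
  exists2 xi, y <= xi <= x &
    barrier b A t (x - y) - 2 * e * t <= (u t xi + e) * (x - y).
Proof.
move=> fL [[M0 u0M] u0u] um T0 e0 A0 init.
have [uC uE] := um.
have u00 x : u 0 x = u0 x.
  by rewrite uE// eqxx set_itv1 Rintegral_set1 addr0.
(* The extra unit of time leaves room for [t + d] with [d <= 1]. *)
have T10 : 0 <= T + 1 by rewrite addr_ge0.
have [M [MG [L1 [M_gt0 MG0 L10 uM [G_lip Gc GM Gt]]]]] := forcing_regularity fL uC T10.
(* Bounds the slope [U] as well as [u], since [U t] differs from [u (t + d)] by at most
   [4 MG sqrt d] and [d <= 1]. *)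
pose M2 := M + 4 * MG.
have MM2 : M <= M2 by rewrite lerDl mulr_ge0.
have [L2 L20 f2] := ge0_norm_lipschitz fL (lt_le_trans M_gt0 MM2).
have e40 : 0 < e / 4 by rewrite divr_gt0.
have L21 : 0 < L2 + 1 by rewrite ltr_wpDl.
have L11 : 0 < L1 + 1 by rewrite ltr_wpDl.
(* Budget: [U] is within [2 e1] of [u], one [e1] for the Duhamel tail and one for the time shift, so
   [f] changes by at most [e / 2]. Smoothing [f(u)] costs [e / 4] near and [e / 4] in the tails, in
   total [e]. *)
pose e1 := e / 4 / (L2 + 1).
have e10 : 0 < e1 by rewrite divr_gt0.
have e1E : (L2 + 1) * e1 = e / 4 by rewrite mulrC divfK// lt0r_neq0.
have e1e : e1 <= e / 4 by rewrite -e1E ler_peMl ?lerDr// ltW.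
have Le1 : L2 * e1 <= e / 4 by rewrite -e1E ler_wpM2r ?lerDl// ltW.
pose e2 := e / 4 / (L1 + 1).
have e20 : 0 < e2 by rewrite divr_gt0.
have e2E : (L1 + 1) * e2 = e / 4 by rewrite mulrC divfK// lt0r_neq0.
have Le2 : L1 * e2 <= e / 4 by rewrite -e2E ler_wpM2r ?lerDl// ltW.
have [dt dt0 u_time] := curve_C_ub_unif_time (T + 1) uC e10.
have [rho rho0 u_space] := curve_C_ub_unif_space (T + 1) uC e20.
have K30 : 0 <= 32 * MG / rho ^+ 2 by rewrite divr_ge0 ?sqr_ge0// mulr_ge0.
have MG4 : 0 <= 4 * MG by rewrite mulr_ge0.
have [d [d0 d1 d_dt d_sqrt d_K3]] := ex_small_step MG4 K30 e10 e40 dt0.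
have T01 t : 0 <= t <= T -> 0 <= t <= T + 1.
  by move=> /andP[-> /le_trans]; apply; rewrite lerDl.
pose G s y := f (u s y).
have Gc' s : 0 <= s <= T -> continuous (G s) by move=> /T01; exact: Gc.
have GM' s : 0 <= s <= T -> forall y, `|G s y| <= MG by move=> /T01; exact: GM.
have Gt' s0 : 0 <= s0 <= T -> forall e', 0 < e' -> exists2 r, 0 < r &
    forall s, 0 <= s <= T -> `|s - s0| < r -> forall y, `|G s y - G s0 y| <= e'.
  by move=> /T01/Gt H e' /H[r r0 Hr]; exists r => // s /T01; exact: Hr.
have [C C0 [est stab]] := ex_heat_sg_estimates (T + d) d0.
have u0c := unif_cont_continuous u0u.
have dPhi t x := is_derive_potential C0 u0c u0M Gc' GM' Gt' est stab (t := t) x.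
have dU t x := is_derive_potential_dx C0 u0c u0M Gc' GM' Gt' est stab (t := t) x.
have Phi_t t x y e' :=
  potential_time_derivative C0 u0c u0M Gc' GM' Gt' est stab (t := t) x y (e := e').
have Phi_lip s t x :=
  potential_time_lipschitz T0 C0 u0c u0M Gc' GM' Gt' est stab (s := s) (t := t) x.
have U_le t x :=
  potential_dx_le C0 u0c u0M Gc' GM' Gt' est stab (t := t) x d0.
have td1 t : 0 <= t <= T -> 0 <= t + d <= T + 1.
  by move=> /andP[t0 tT]; rewrite addr_ge0 ?(ltW d0)//= lerD.
have U_tail t x : 0 <= t <= T ->
    `|u (t + d) x - potential_dx u0 G d t x| <= 4 * MG * Num.sqrt d.
  move=> tT; have /andP[t0 _] := tT; have /andP[_ tdT] := td1 _ tT.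
  exact: (mild_solution_tail x um Gc GM Gt d0 t0 tdT).
pose H t x := heat_sg d (G t) x.
have Phi_t' t x y e' : 0 < t <= T -> 0 < e' -> exists2 r, 0 < r &
    forall h, 0 < h < r -> h <= t ->
    `|(potential u0 G d t x - potential u0 G d t y) -
      (potential u0 G d (t - h) x - potential u0 G d (t - h) y) -
      h * ((potential_dxx u0 G d t x + H t x) - (potential_dxx u0 G d t y + H t y))| <= e' * h.
  exact: Phi_t.
move: (potential u0 G d) (potential_dx u0 G d) (potential_dxx u0 G d)
  dPhi dU {Phi_t} Phi_t' Phi_lip U_le U_tail => Phi U V dPhi dU Phi_t Phi_lip U_le U_tail.
have U_u t x : 0 <= t <= T -> `|U t x - u t x| <= e1 + e1.
  move=> tT; have /andP[t0 tT'] := tT.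
  apply: (le_trans (ler_distD (u (t + d) x) _ _)); apply: lerD.
    by rewrite distrC; apply: (le_trans (U_tail _ x tT)).
  apply: u_time; first exact: T01.
  - by rewrite addr_ge0// ltW.
  - by rewrite addrAC subrr add0r gtr0_norm.
have U_u' t x : 0 <= t <= T -> `|U t x - u t x| <= e.
  by move=> /(U_u _ x)/le_trans; apply; move: e1e e0; clear; lra.
have U_le2 t x : 0 <= t <= T -> `|U t x| <= M2.
  move=> tT; rewrite -[U t x](subKr (u (t + d) x)); apply: (le_trans (ler_normB _ _)).
  apply: lerD; first exact: uM (td1 _ tT) _.
  apply: (le_trans (U_tail _ x tT)); rewrite ler_piMr//.
  by rewrite -[leRHS]sqrtr1; exact: ler_wsqrtr.
have H_near t x : 0 <= t <= T -> `|H t x - f (U t x)| <= e.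
  move=> tT; have tT1 := T01 _ tT.
  have Gs y z : `|y - z| < rho -> `|G t y - G t z| <= e / 4.
    move=> yz; apply: (le_trans (G_lip _ _ _ _ tT1 tT1)).
    by apply: le_trans Le2; rewrite ler_wpM2l//; exact: u_space.
  have h1 := heat_sg_near x d0 (ltW e40) rho0 (Gc _ tT1) (GM _ tT1) Gs.
  have uM2 : `|u t x| <= M2 := le_trans (uM _ tT1 x) MM2.
  have h2 := f2 _ _ uM2 (U_le2 _ x tT).
  have h3 : L2 * `|u t x - U t x| <= L2 * (e1 + e1).
    by rewrite ler_wpM2l// distrC; exact: U_u.
  apply: (le_trans (ler_distD (G t x) _ _)).
  apply: (le_trans (lerD h1 (le_trans h2 h3))).
  by move: d_K3 Le1; clear; move: (32 * MG / rho ^+ 2 * d) => k; lra.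
clearbody H.
have H_ge t x y : 0 <= t <= T ->
    - (L2 * `|U t x - U t y| + 2 * e) <= H t x - H t y.
  move=> tT; have := H_near _ x tT; have := H_near _ y tT.
  have := f2 _ _ (U_le2 _ x tT) (U_le2 _ y tT); clear.
  by rewrite !ler_norml => /andP[? ?] /andP[? ?] /andP[? ?]; lra.
have Phi0 x y : y <= x -> barrier b A 0 (x - y) <= Phi 0 x - Phi 0 y.
  have z0 : (0 : R) <= 0 <= T by apply/andP; split.
  apply: (init _ (U 0)) => w; first exact: dPhi.
  by rewrite -u00; exact: U_u'.
move=> t x y tT yx.
have mb := modulus_bound T0 L20 A0 (ltW e0) dPhi dU Phi_t Phi_lip U_le H_ge Phi0 tT yx.
have [xi] := MVT_between (fun z (_ : Num.min y x <= z <= Num.max y x) => dPhi t z tT).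
rewrite (min_idPl yx) (max_idPr yx) => yxix E; exists xi => //.
apply: (le_trans mb); rewrite E ler_wpM2r ?subr_ge0//.
by have := U_u' _ xi tT; rewrite ler_norml lerBlDl => /andP[].
Qed.

End Approximation.

(** * Eventual positivity for positive limits, and reflection *)

Section Positivity.
Variable R : realType.
Notation mu := (@lebesgue_measure R).
Implicit Types (t s x y e : R).

(** Outside some [[-N, N]] the limits give [g > a]. Inside, [B = (a + M) (1 + N^2)] makes the
    correction at least [a + M], so the left side is at most [- M]. *)
Lemma limits_lower_bound (g : R -> R) (l m a M : R) :
  g x @[x --> +oo] --> l -> g x @[x --> -oo] --> m -> a < l -> a < m -> 0 <= a ->
  (forall x, `|g x| <= M) ->
  exists2 B, 0 <= B & forall x, a - B * (1 + x ^+ 2)^-1 <= g x.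
Proof.
move=> gl gm al am a0 gM.
have l0 : 0 < l - a by rewrite subr_gt0.
have m0 : 0 < m - a by rewrite subr_gt0.
move/cvgrPdist_lt/(_ _ l0): gl => [N1 [_ H1]].
move/cvgrPdist_lt/(_ _ m0): gm => [N2 [_ H2]].
have M0 : 0 <= M by apply: le_trans (gM 0).
pose N := `|N1| + `|N2|.
have N0 : 0 <= N by rewrite addr_ge0.
have B0 : 0 <= (a + M) * (1 + N ^+ 2).
  by rewrite mulr_ge0 ?addr_ge0 ?sqr_ge0.
exists ((a + M) * (1 + N ^+ 2)) => // x.
have x1 : 0 < 1 + x ^+ 2 by rewrite ltr_pwDl ?sqr_ge0.
have Bx : 0 <= (a + M) * (1 + N ^+ 2) * (1 + x ^+ 2)^-1.
  by rewrite mulr_ge0// invr_ge0 ltW.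
have [xN|Nx] := leP `|x| N.
  have : a + M <= (a + M) * (1 + N ^+ 2) * (1 + x ^+ 2)^-1.
    rewrite ler_pdivlMr// ler_wpM2l ?addr_ge0// lerD2l.
    by rewrite -(real_normK (num_real x)) lerXn2r ?nnegrE.
  by have := gM x; rewrite ler_norml => /andP[? ?]; lra.
suff : a < g x by lra.
have n1 := ler_norm N1; have n2 := ler_norm (- N2); rewrite normrN in n2.
have p1 := normr_ge0 N1; have p2 := normr_ge0 N2.
have [x0|x0] := leP 0 x.
  have /H1 : N1 < x by move: Nx; rewrite /N (ger0_norm x0); lra.
  by rewrite /= ltr_norml => /andP[? ?]; lra.
have /H2 : x < N2 by move: Nx; rewrite /N (ltr0_norm x0); lra.
by rewrite /= ltr_norml => /andP[? ?]; lra.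
Qed.

(* Since [1 / (1 + x^2)] has the bounded antiderivative [atan], a function that stays
   above [2 b] up to this error has primitives growing at least like [b z] at large
   distance, and the barrier absorbs the remaining distances. *)
Lemma barrier_init (p q : R -> R) (b B K x y : R) : 0 < b -> 0 <= B -> 0 <= K ->
  (forall x, is_derive x (1:R) p (q x)) -> (forall x, - K <= q x) ->
  (forall x, 2 * b - B * (1 + x ^+ 2)^-1 <= q x) -> y <= x ->
  barrier b ((K + b) * expR ((B * pi / b) ^+ 2 / 16)) 0 (x - y) <= p x - p y.
Proof.
move=> b0 B0 K0 dp qK qB yx.
(* Beyond [z1] the total loss [B pi] is at most [b z]. Up to [z1] the exponential in [A] cancels the
   Gaussian, so the barrier lies below [- K z]. *)
set z1 := B * pi / b; set z := x - y.
have z0 : 0 <= z by rewrite subr_ge0.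
have E0 := expR_gt0 (z1 ^+ 2 / 16).
have Kb0 : 0 <= K + b by rewrite addr_ge0// ltW.
have A0 : 0 <= (K + b) * expR (z1 ^+ 2 / 16) by rewrite mulr_ge0// ltW.
have [zz1|z1z] := leP z z1.
  have low : - K * z <= p x - p y.
    have [w _ ->] := MVT_between (fun w (_ : Num.min y x <= w <= Num.max y x) => dp w).
    by rewrite ler_wpM2r.
  apply: le_trans low; rewrite /barrier addr0 invr1 mul1r mulr1.
  have : (K + b) * z <= (K + b) * expR (z1 ^+ 2 / 16) * z * expR (- z ^+ 2 / 16).
    rewrite (_ : (K + b) * expR (z1 ^+ 2 / 16) * z * expR (- z ^+ 2 / 16) =
      (K + b) * z * (expR (z1 ^+ 2 / 16) * expR (- z ^+ 2 / 16))); last by ring.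
    apply: ler_peMr; first exact: mulr_ge0.
    rewrite -expRD -[leLHS]expR0 ler_expR.
    rewrite mulNr subr_ge0 ler_pM2r ?invr_gt0// lerXn2r ?nnegrE//.
    by rewrite divr_ge0 ?mulr_ge0 ?pi_ge0// ltW.
  by lra.
apply: (le_trans (barrier_le b A0 (lexx 0) z0)).
have dF w : is_derive w (1:R) (fun w => p w + (B * atan w - 2 * b * w))
    (q w + (B * (1 + w ^+ 2)^-1 - 2 * b)).
  have dat := is_derive_mul (is_derive_cst B w 1) (is_derive1_atan w).
  have /is_derive_eq := is_derive_add (dp w)
    (is_derive_add dat (is_derive_opp (is_derive_affine (2 * b) w))).
  by apply; rewrite mul0r add0r.
have [w _] := MVT_between (fun w (_ : Num.min y x <= w <= Num.max y x) => dF w).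
rewrite -/z => E.
have : 0 <= (q w + (B * (1 + w ^+ 2)^-1 - 2 * b)) * z.
  by rewrite mulr_ge0//; have := qB w; lra.
rewrite -E.
have at1 := atan_ltpi2 x; have at2 := atan_gtNpi2 y.
have Bpi : B * (atan x - atan y) <= B * pi by rewrite ler_wpM2l//; lra.
have : B * pi <= b * z by move: z1z; rewrite /z1 ltr_pdivrMr// => h; lra.
by rewrite /z; lra.
Qed.

Lemma mild_solution_eventually_gt0 (f u0 : R -> R) (phip phim : R) (u : R -> R -> R) :
  locally_lipschitz f -> C_ub u0 ->
  u0 x @[x --> +oo] --> phip -> u0 x @[x --> -oo] --> phim ->
  0 < phip -> 0 < phim -> mild_solution f u0 u ->
  exists T, 0 < T /\ forall t, T < t -> forall x, 0 < u t x.
Proof.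
move=> fL u0C u0p u0m p0 m0 um; have [[M u0M] _] := u0C; have [[uC _] _] := um.
(* Then [3 b] is half of the smaller limit: one [b] absorbs the perturbation [e <= b] of [u0], and
   [2 b] remains for [barrier_init]. *)
pose b := Num.min phip phim / 6.
have min0 : 0 < Num.min phip phim by rewrite lt_min p0.
have b0 : 0 < b by rewrite divr_gt0.
have [bp bm] : 3 * b < phip /\ 3 * b < phim.
  have : Num.min phip phim <= phip /\ Num.min phip phim <= phim.
    by rewrite !ge_min !lexx orbT.
  by rewrite /b => -[]; move: min0; move: (Num.min _ _) => w; split; lra.
have b3 : 0 <= 3 * b by rewrite mulr_ge0// ltW.
have [B B0 u0B] := limits_lower_bound u0p u0m bp bm b3 u0M.
have M0 : 0 <= M by apply: le_trans (u0M 0).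
have K0 : 0 <= M + b by rewrite addr_ge0// ltW.
pose A := (M + b + b) * expR ((B * pi / b) ^+ 2 / 16).
have A0 : 0 < A by rewrite mulr_gt0 ?expR_gt0// ltr_wpDl.
(* Past this time [A < b (1 + t)], so the slope [eta] of the barrier at [z = 0] is positive. *)
exists (A / b); split; first by rewrite divr_gt0.
move=> t Abt x; have t0 : 0 < t by apply: lt_trans Abt; rewrite divr_gt0.
have t1 : 0 < 1 + t by rewrite ltr_pwDl// ltW.
pose eta := b - A / (1 + t).
have eta0 : 0 < eta.
  rewrite subr_gt0 ltr_pdivrMr//; move: Abt; rewrite ltr_pdivrMr// => h.
  by apply: (lt_trans h); rewrite mulrDr mulr1 mulrC ltrDr.
have [_ uu] := uC t (ltW t0).
have eta8 : 0 < eta / 8 by rewrite divr_gt0.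
have [d [d0 ud]] := uu _ eta8.
(* A fixed small separation replaces the limit [y -> x]: on [[x, x + z]] the function [u t] varies
   by less than [eta / 8]. *)
pose z := d / 2; have z0 : 0 < z by rewrite divr_gt0.
have ez0 : 0 < eta * z / 8 / t by rewrite !divr_gt0// mulr_gt0.
(* The loss [2 e t] is at most [eta z / 4]; subtracting [e] and the oscillation, each at most
   [eta / 8], leaves [u t x > eta / 2]. *)
pose e := Num.min (Num.min b (eta / 8)) (eta * z / 8 / t).
have e0 : 0 < e by rewrite !lt_min b0 eta8 ez0.
have eb : e <= b by rewrite !ge_min lexx.
have e8 : e <= eta / 8 by rewrite !ge_min lexx orbT.
have et : e * t <= eta * z / 8 by rewrite -ler_pdivlMr// !ge_min lexx !orbT.
have init (p q : R -> R) : (forall x, is_derive x (1:R) p (q x)) ->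
    (forall x, `|q x - u0 x| <= e) ->
    forall x y, y <= x -> barrier b A 0 (x - y) <= p x - p y.
  move=> dp qu x1 y1 yx1; apply: (barrier_init b0 B0 K0 dp _ _ yx1) => w.
    by have := qu w; have := u0M w; rewrite !ler_norml => /andP[? ?] /andP[? ?]; lra.
  have := qu w; have := u0B w; rewrite ler_norml.
  by move: (B * _) => k ? /andP[? ?]; lra.
have tt : 0 <= t <= t by rewrite (ltW t0) lexx.
have xz : x <= x + z by rewrite lerDl ltW.
have [xi /andP[xi1 xi2]] := mild_solution_modulus fL u0C um (ltW t0) e0 (ltW A0) init tt xz.
rewrite (_ : x + z - x = z); last by ring.
have bar : eta * z <= barrier b A t z.
  rewrite /barrier /eta mulrBl lerD2l lerN2.
  rewrite (_ : A / (1 + t) * z = A * z * ((1 + t)^-1 * 1)); last by ring.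
  apply: ler_wpM2l; first by apply: mulr_ge0; exact: ltW.
  apply: ler_wpM2l; first by rewrite invr_ge0 ltW.
  rewrite -[leRHS]expR0 ler_expR mulNr oppr_le0 divr_ge0 ?sqr_ge0//.
  by rewrite mulr_ge0// ltW.
move=> H.
have H2 : (eta * 3 / 4) * z <= (u t xi + e) * z by lra.
rewrite ler_pM2r// in H2.
have : `|xi - x| < d by rewrite ger0_norm ?subr_ge0// /z in xi2 *; lra.
by move=> /ud; rewrite ltr_norml => /andP[? ?]; lra.
Qed.

(** Reflection exchanges negative and positive limits. Pulling the sign out of the integrals rests
    on their integrability, which includes the singular Duhamel integrand. *)
Lemma mild_solutionN (f u0 : R -> R) (u : R -> R -> R) :
  locally_lipschitz f -> C_ub u0 -> mild_solution f u0 u ->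
  mild_solution (fun v => - f (- v)) (fun x => - u0 x) (fun t x => - u t x).
Proof.
move=> fL [[M0 u0M] u0u] [[uC ut] uE]; split.
  split.
    move=> t /uC[[M uM] uu]; split; first by exists M => x; rewrite normrN.
    by move=> e /uu[d [d0 H]]; exists d; split => // x y /H; rewrite -opprD normrN.
  move=> t0 t00 e e0; have [d [d0 H]] := ut t0 t00 e e0; exists d; split => //.
  by move=> t /H{}H td x; rewrite -opprD normrN; exact: H.
move=> t t0 x; rewrite uE//.
have [->|tn0] := eqVneq t 0.
  by rewrite set_itv1 !Rintegral_set1 !addr0.
have tpos : 0 < t by rewrite lt_neqAle eq_sym tn0.
have [M [MG [L [_ MG0 _ _ [_ Gc GM Gt]]]]] := forcing_regularity fL (conj uC ut) t0.
have u0c := unif_cont_continuous u0u.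
rewrite opprD; congr (_ + _).
  symmetry; apply: (kconvN _ tpos (continuous_heat_kernel tpos) u0c _ u0M) => z.
  exact: heat_kernel_norm.
have cF := @dx_heat_sg_cont_on R (fun s y => f (u s y)) MG t t x.
have {}cF : cont_on `[0, t[ (fun s => dx_heat_sg (t - s) (fun y => f (u s y)) x).
  by apply: cF => //; rewrite tpos lexx.
have MG2 : 0 <= 2 * MG by rewrite mulr_ge0.
have FK s : 0 <= s < t -> `|dx_heat_sg (t - s) (fun y => f (u s y)) x| <=
    2 * MG * (Num.sqrt (t - s))^-1.
  move=> /andP[s0 st]; have sT : 0 <= s <= t by rewrite s0 ltW.
  rewrite mulrAC; apply: dx_heat_sg_le; [by rewrite subr_gt0|exact: Gc|exact: GM].
have [iF _] := singular_integrable tpos MG2 cF FK.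
rewrite -mulN1r -RintegralZl//; apply: eq_Rintegral => s.
rewrite inE /= in_itv/= => /andP[s0 st]; rewrite mulN1r.
have negE : (fun y => - f (- - u s y)) = (fun y => - f (u s y)).
  by apply/funext => y; rewrite opprK.
rewrite negE.
(* At the endpoint [s = t] the kernel has age 0 and is identically 0, because division by 0 yields
   0. *)
move: st; rewrite le_eqVlt => /predU1P[->|st].
  have z0 g : dx_heat_sg 0 g x = 0 :> R.
    rewrite /dx_heat_sg (_ : (fun y => _) = cst 0); first by rewrite Rintegral_cst// mul0r.
    by apply/funext => y; rewrite /heat_kernel_dx mulr0 invr0 mulr0 oppr0 !mul0r.
  by rewrite subrr !z0 oppr0.
have ts0 : 0 < t - s by rewrite subr_gt0.
have sT : 0 <= s <= t by rewrite s0 ltW.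
have ts20 : 0 < 2 * (t - s) by rewrite mulr_gt0.
symmetry; apply: (kconvN _ ts20 (continuous_heat_kernel_dx ts0) (Gc _ sT) _ (GM _ sT)) => z.
exact: heat_kernel_dx_le.
Qed.

End Positivity.

Theorem theorem3p5 (R : realType) (f : R -> R) (u0 : R -> R)
    (phip phim : R) (u : R -> R -> R) :
  locally_lipschitz f ->
  C1_ub u0 ->
  u0 x @[x --> +oo] --> phip ->
  u0 x @[x --> -oo] --> phim ->
  phip != 0 -> phim != 0 ->
  ((0 < phip /\ 0 < phim) \/ (phip < 0 /\ phim < 0)) ->
  mild_solution f u0 u ->
  exists T : R, 0 < T /\ forall t : R, T < t -> forall x : R, u t x != 0.
Proof.
move=> fL [_ [_ [u0C _]]] u0p u0m _ _ phi_sign um.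
case: phi_sign => -[p0 m0].
  have [T [T0 uT]] := mild_solution_eventually_gt0 fL u0C u0p u0m p0 m0 um.
  by exists T; split => // t Tt x; rewrite lt0r_neq0// uT.
have fL' : locally_lipschitz (fun v => - f (- v)).
  move=> M M0; have [L HL] := fL M M0; exists L => x y xM yM.
  rewrite -opprD normrN -(normrN (x - y)) opprD.
  by apply: HL; rewrite normrN.
have u0C' : C_ub (fun x => - u0 x).
  case: u0C => -[M u0M] u0u; split; first by exists M => x; rewrite normrN.
  by move=> e /u0u[d [d0 H]]; exists d; split => // x y /H; rewrite -opprD normrN.
have [T [T0 uT]] := mild_solution_eventually_gt0 fL' u0C' (cvgN u0p) (cvgN u0m)
  (eqbRL (oppr_gt0 _) p0) (eqbRL (oppr_gt0 _) m0) (mild_solutionN fL u0C um).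
by exists T; split => // t Tt x; rewrite -oppr_eq0 lt0r_neq0// uT.
Qed.
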